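(* Let $G$ be a finite abelian group. The clone of congruence preserving functions of $G$ is finitely generated if and only if every Sylow subgroup of $G$ is cyclic or affine complete.
   Context: For an algebra $\mathbf{A}$ with (nonempty) universe $A$, a function $f:A^k\to A$ is congruence preserving if for every congruence $\alpha$ of $\mathbf{A}$ and all $(a_1,b_1),\dots,(a_k,b_k)\in\alpha$ we have $(f(a_1,\dots,a_k),f(b_1,\dots,b_k))\in\alpha$. The congruence preserving functions of all arities $k\ge 1$ form a clone on $A$ (a set of finitary operations containing all projections and closed under composition), denoted $\mathrm{Comp}(\mathbf{A})$. It is finitely generated if there is a finite subset $F\subseteq\mathrm{Comp}(\mathbf{A})$ such that every function in $\mathrm{Comp}(\mathbf{A})$ is a composition of projections and functions in $F$. Groups are regarded as algebras with their group operations; congruences of an abelian group correspond to its subgroups, so $f:G^k\to G$ is congruence preserving if and only if for all $g,h\in G^k$ the element $f(g)-f(h)$ lies in the subgroup generated by $\{g_1-h_1,\dots,g_k-h_k\}$. An algebra is affine complete if every congruence preserving function of it (of any arity) is a polynomial function, i.e. is of the form $(x_1,\dots,x_k)\mapsto t(x_1,\dots,x_k,a_1,\dots,a_l)$ for some term function $t$ and some constants $a_1,\dots,a_l$ in the algebra. *)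

(* Defs.v *)
From Stdlib Require Import RelationClasses.
From mathcomp Require Import all_boot all_fingroup all_solvable.

Set Implicit Arguments.
Unset Strict Implicit.
Unset Printing Implicit Defensive.

Definition operation (A : Type) (k : nat) := k.-tuple A -> A.

Record algebra := Algebra {
  carrier :> Type;
  symbol : Type;
  arity : symbol -> nat;
  basic_op : forall s : symbol, operation carrier (arity s)
}.

Record congruence (A : algebra) (R : A -> A -> Prop) : Prop := Congruence {
  congruence_equiv : Equivalence R;
  congruence_compat : forall (s : symbol A) (x y : (arity s).-tuple A),
    (forall i, R (tnth x i) (tnth y i)) -> R (basic_op x) (basic_op y)
}.

Definition congruence_preserving (A : algebra) (k : nat) (f : operation A k) :=
  forall R : A -> A -> Prop, congruence R ->
  forall x y : k.-tuple A,
    (forall i, R (tnth x i) (tnth y i)) -> R (f x) (f y).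

(* The premises [=1] make the generated set closed under pointwise equality,  *)
(* so that operations are identified with their graphs without any axiom.     *)
Inductive clone_generated (A I : Type) (ar : I -> nat)
    (F : forall i : I, operation A (ar i)) (n : nat) : operation A n -> Prop :=
| clone_proj (f : operation A n) (j : 'I_n) :
    f =1 (fun x => tnth x j) -> clone_generated F f
| clone_comp (f : operation A n) (i : I) (g : 'I_(ar i) -> operation A n) :
    (forall j, clone_generated F (g j)) ->
    f =1 (fun x => F i [tuple g j x | j < ar i]) -> clone_generated F f.

Definition finitely_generated (A : Type)
    (C : forall k : nat, operation A k -> Prop) : Prop :=
  exists (m : nat) (ar : 'I_m -> nat) (F : forall i : 'I_m, operation A (ar i)),
    (forall i, C (ar i) (F i)) /\
    (forall k (f : operation A k), C k f -> clone_generated F f).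

(* Clones only contain operations of positive arity, whereas the basic        *)
(* operations of an algebra may be nullary.                                   *)
Definition Comp (A : algebra) (k : nat) (f : operation A k) : Prop :=
  0 < k /\ congruence_preserving f.

Definition term_function (A : algebra) (k : nat) (t : operation A k) : Prop :=
  clone_generated (@basic_op A) t.

Definition polynomial_function (A : algebra) (k : nat) (f : operation A k) :=
  exists (l : nat) (a : l.-tuple A) (t : operation A (k + l)),
    term_function t /\ forall x : k.-tuple A, f x = t [tuple of x ++ a].

Definition affine_complete (A : algebra) : Prop :=
  forall (k : nat) (f : operation A k), Comp f -> polynomial_function f.

Inductive group_symbol := GroupOne | GroupInv | GroupMul.

Definition group_arity (s : group_symbol) : nat :=
  match s with GroupOne => 0 | GroupInv => 1 | GroupMul => 2 end.

Definition group_op (G : groupType) (s : group_symbol) :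
    operation G (group_arity s) :=
  match s return operation G (group_arity s) with
  | GroupOne => fun=> 1%g
  | GroupInv => fun x => (tnth x ord0)^-1%g
  | GroupMul => fun x => (tnth x ord0 * tnth x ord_max)%g
  end.

Definition group_algebra (G : groupType) : algebra := Algebra (@group_op G).

(* Main.v *)
Require Import Defs.
From HB Require Import structures.
From mathcomp Require Import all_boot all_fingroup all_solvable.
From mathcomp Require Import ssralg finalg zmodp.

Set Implicit Arguments.
Unset Strict Implicit.
Unset Printing Implicit Defensive.

Import GRing.Theory FinRing.Theory.
Local Open Scope ring_scope.

(** A congruence of an abelian group is given by a subgroup, so f preserves all
    congruences as soon as changing one argument by u changes the value of f
    by a multiple of u (CompP).  Everything below uses this local condition,
    in additive notation.

    _Reduction to Sylow subgroups._  A Sylow subgroup P is a retract of G: the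
    projection x |-> x.`_p is a homomorphism onto P, and x.`_p is a power of x.
    Hence a compatible f on P extends to f o pi on G, and a compatible g on G
    satisfies pi (g x) = pi (g (pi x)).  Finite generation therefore passes
    from G to P.  Conversely f x is the product of its p-components, so
    generators for all the P, lifted to G, and the multiplication generate the
    compatible functions of G.

    _Sylow subgroups that give finite generation._ If P is affine complete,
    the multiplication and the constants generate. If P is cyclic of order
    p^n, then its subgroups p^i P form a chain, and a compatible f can be
    corrected one coset of p^(i+1) P at a time, by indicator functions with
    value in p^i P. For each i < n a single binary operation, which combines
    two conditions modulo p^(i+1) P into one, suffices to build these
    indicators with the help of the addition and the constants
    (cyclic_generation).

    _The other Sylow subgroups._  Let P be a p-group which is not cyclic, and
    write P = <e1> + <e2> + R with orders p^a and p^b of e1 and e2, where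
    0 < b <= a and p^b kills e2 and R.  Compare f e1 - f e2, a multiple of
    e1 - e2, with the values at e1 and at e2: the two slopes agree modulo p^b.
    This rigidity makes every compatible function affine modulo p^b P
    (compatible_affine_mod).  If a = b, then p^b P = 0 and P is affine
    complete.

    If b < a, then f = affine + h with values of h in p^b P, and the same
    rigidity makes h constant along the elements killed by p^b. It follows
    that h modulo p^(j+1) P depends on its arguments modulo p^j P only
    (remainder_lifting). On the other hand every map between finite abelian
    p-groups is killed by all D-fold differences, for some D which depends on
    the two groups only (bounded_degree), so it turns sums of functions of at
    most d variables into sums of functions of at most D * d variables
    (few_variables_comp). By induction on j, there is for every finite set of
    compatible functions a bound d_j such that everything it generates is,
    modulo p^j P, a sum of functions of at most d_j variables, whatever its
    arity (bounded_variables). At j = a this is an exact statement about P.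
    But the function with value p^(a-1) e1 where all arguments have order p^a,
    and 0 elsewhere, is compatible in each arity k (spike), and an alternating
    sum over the vertices of a k-dimensional cube shows that it is not a sum
    of functions of fewer than k variables. *)

(** * Clones and their generators *)

Lemma eq_clone (A I : Type) (ar : I -> nat)
    (F : forall i : I, operation A (ar i)) k (f g : operation A k) :
  f =1 g -> clone_generated F f -> clone_generated F g.
Proof.
move=> eqfg cf; case: f / cf eqfg => [f j fE|f i e ce fE] eqfg.
  by apply: (@clone_proj _ _ _ _ _ _ j) => x; rewrite -eqfg fE.
by apply: (clone_comp ce) => x; rewrite -eqfg fE.
Qed.

(** Only the generators may head a composition in a generated clone; closure
    under composition of arbitrary members is this induction. *)
Lemma clone_substitution (A I : Type) (ar : I -> nat)
    (F : forall i : I, operation A (ar i)) n (f : operation A n)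
    k (g : 'I_n -> operation A k) :
    clone_generated F f -> (forall j, clone_generated F (g j)) ->
  clone_generated F (fun x => f [tuple g j x | j < n]).
Proof.
move=> cf cg; elim: cf => {f} [f j fE|f i e ce IHe fE].
  by apply: (eq_clone _ (cg j)) => x; rewrite fE tnth_mktuple.
by apply: (clone_comp IHe) => x; rewrite fE.
Qed.

Lemma clone_generated_sub (A I J : Type) (ar : I -> nat) (br : J -> nat)
    (F : forall i : I, operation A (ar i))
    (F' : forall j : J, operation A (br j)) n (f : operation A n) :
    (forall i, clone_generated F' (F i)) ->
  clone_generated F f -> clone_generated F' f.
Proof.
move=> sFF' cf; elim: cf => {f} [f j fE|f i g _ cg fE].
  exact: clone_proj fE.
by apply: (eq_clone _ (clone_substitution (sFF' i) cg)) => x; rewrite fE.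
Qed.

Lemma clone_app (A I : Type) (ar : I -> nat)
    (F : forall i : I, operation A (ar i)) i k
    (g : 'I_(ar i) -> operation A k) :
    (forall j, clone_generated F (g j)) ->
  clone_generated F (fun x => F i [tuple g j x | j < ar i]).
Proof. by move=> cg; apply: (clone_comp (i := i) cg). Qed.

Lemma clone_generator (A I : Type) (ar : I -> nat)
    (F : forall i : I, operation A (ar i)) i : clone_generated F (F i).
Proof.
have cg j : clone_generated F (fun x : (ar i).-tuple A => tnth x j).
  exact: (@clone_proj _ _ _ _ _ _ j).
apply: (eq_clone _ (clone_app cg)) => x.
by congr (F i _); apply: eq_from_tnth => j; rewrite tnth_mktuple.
Qed.

(** Generators may be indexed by any finite type, so that families can be put
    together by sum types. *)
Lemma finitely_generated_fin (A : Type) (C : forall k, operation A k -> Prop)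
    (I : finType) (ar : I -> nat) (F : forall i, operation A (ar i)) :
    (forall i, C (ar i) (F i)) ->
    (forall k (f : operation A k), C k f -> clone_generated F f) ->
  finitely_generated C.
Proof.
move=> CF genF; exists #|I|, (ar \o enum_val), (fun j => F (enum_val j)).
split=> [j|k f /genF]; first exact: CF.
apply: clone_generated_sub => i; rewrite -(enum_rankK i).
exact: (clone_generator (fun j : 'I_#|I| => F (enum_val j))).
Qed.

(** * Changing one coordinate of a tuple *)

Section Tuples.

Variables (T : Type) (k : nat).
Implicit Types (x y : k.-tuple T) (i : 'I_k).

Definition tset x i u : k.-tuple T :=
  [tuple if j == i then u else tnth x j | j < k].

Lemma tnth_tset x i u j : tnth (tset x i u) j = if j == i then u else tnth x j.
Proof. by rewrite tnth_mktuple. Qed.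

Lemma tset_id x i : tset x i (tnth x i) = x.
Proof.
by apply: eq_from_tnth => j; rewrite tnth_tset; case: eqP => // ->.
Qed.

Lemma tsetK x i u v : tset (tset x i u) i v = tset x i v.
Proof. by apply: eq_from_tnth => j; rewrite !tnth_tset; case: eqP. Qed.

Lemma tsetC x i j u v : i != j -> tset (tset x i u) j v = tset (tset x j v) i u.
Proof.
move=> ij; apply: eq_from_tnth => l; rewrite !tnth_tset.
by case: eqP => // ->; rewrite eq_sym (negPf ij).
Qed.

(** Walk from y to x through the tuples whose first m entries are those of x:
    each step changes one coordinate, which still has its value in y. *)
Lemma coordinatewise_ind (Q : k.-tuple T -> Prop) x y :
    Q y ->
    (forall z i, tnth z i = tnth y i -> Q z -> Q (tset z i (tnth x i))) ->
  Q x.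
Proof.
move=> Qy Qset.
pose mix m : k.-tuple T :=
  [tuple if (j < m)%N then tnth x j else tnth y j | j < k].
have mixE m j : tnth (mix m) j = if (j < m)%N then tnth x j else tnth y j.
  by rewrite tnth_mktuple.
have Qmix m : (m <= k)%N -> Q (mix m).
  elim: m => [_|m IHm ltmk].
    by have -> // : mix 0%N = y; apply: eq_from_tnth => j; rewrite mixE.
  have -> : mix m.+1 = tset (mix m) (Ordinal ltmk) (tnth x (Ordinal ltmk)).
    apply: eq_from_tnth => j; rewrite tnth_tset !mixE ltnS leq_eqVlt.
    have -> : (j == Ordinal ltmk) = (j == m :> nat) by [].
    case: eqP => //= jm; congr tnth; exact/val_inj.
  by apply: Qset (IHm (ltnW ltmk)); rewrite mixE ltnn.
have <- // : mix k = x; last exact: Qmix.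
by apply: eq_from_tnth => j; rewrite mixE ltn_ord.
Qed.

End Tuples.

(** * Congruence preservation, one coordinate at a time *)

Section Cycles.

Variable A : finZmodType.
Implicit Types (u v w : A).

Lemma mulrn_cycle w n : w *+ n \in <[w]>%g. Proof. exact: mem_cycle. Qed.

Lemma mem0_cycle w : 0 \in <[w]>%g. Proof. exact: group1. Qed.

Lemma addr_cycle u v w :
  u \in <[w]>%g -> v \in <[w]>%g -> u + v \in <[w]>%g.
Proof. exact: groupM. Qed.

Lemma oppr_cycle u w : (- u \in <[w]>%g) = (u \in <[w]>%g).
Proof. exact: groupV. Qed.

Lemma mulrn_in_cycle u w n : u \in <[w]>%g -> u *+ n \in <[w]>%g.
Proof. exact: groupX. Qed.

Lemma mem_cycleP u w : reflect (exists n, u = w *+ n) (u \in <[w]>%g).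
Proof. exact: cycleP. Qed.

End Cycles.

(** A local form of congruence preservation, which is equivalent to it for
    finite abelian groups (CompP) and does not mention congruences. *)
Definition coordinate_compatible (A : finZmodType) k (f : operation A k) :=
  forall x i u, f (tset x i u) - f x \in <[u - tnth x i]>%g.

Lemma subgroup_congruence (A : finZmodType) (H : {group A}) :
  congruence (A := group_algebra A) (fun u v => u - v \in H).
Proof.
split=> [|s x y Hxy].
  split=> [u|u v Huv|u v w Huv Hvw]; first by rewrite subrr group1.
    by rewrite -opprB groupV.
  by rewrite -(subrK v u) -addrA groupM.
case: s x y Hxy => x y Hxy /=; rewrite /= ?zmodVgE ?zmodMgE ?zmod1gE.
- by rewrite subrr group1.
- by rewrite -opprD groupV.
- by rewrite opprD addrACA groupM.
Qed.

Lemma congruence_group (A : finZmodType) (R : A -> A -> Prop) :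
    congruence (A := group_algebra A) R ->
  [/\ forall x, R x x, forall x y, R x y -> R y x,
      forall x y z, R x y -> R y z -> R x z &
      forall x y x' y', R x x' -> R y y' -> R (x + y) (x' + y')].
Proof.
case=> [[Rx Rs Rt] Rc]; split=> // x y x' y' Rxx' Ryy'.
apply: (Rc GroupMul [tuple x; y] [tuple x'; y']) => -[[|[|i]] //= lti].
Qed.

(** One direction tests f on the congruence of the subgroup generated by the
    change of the argument.  In the other direction, change the arguments one
    by one; the change of value is a multiple of u - v for related u and v,
    hence related to 0. *)
Lemma CompP (A : finZmodType) k (f : operation A k) :
  Comp (A := group_algebra A) f <-> (0 < k)%N /\ coordinate_compatible f.
Proof.
split=> -[k_gt0 cpf]; split=> //.
  move=> x i u; apply: (cpf _ (subgroup_congruence <[u - tnth x i]>)) => j.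
  rewrite tnth_tset; case: eqP => [->|_]; first exact: cycle_id.
  by rewrite subrr group1.
move=> R /congruence_group[Rx Rs Rt Rd] x y Rxy.
apply: (coordinatewise_ind (Q := fun z => R (f z) (f y))) => // z i zi Rzy.
apply: Rt Rzy; have /mem_cycleP[n] := cpf z i (tnth x i).
move/(canRL (subrK _)) ->; rewrite -[X in R _ X]add0r; apply: (Rd) => //.
rewrite zi; elim: n => [|n IHn]; first by rewrite mulr0n.
rewrite mulrS -[0](addr0 (0 : A)); apply: (Rd) => //.
by rewrite -[X in R _ X](subrr (tnth y i)); apply: Rd.
Qed.

(** * Clones containing the addition *)

Lemma clone_app1 (A I : Type) (ar : I -> nat)
    (F : forall i : I, operation A (ar i)) (u : operation A 1)
    k (f : operation A k) :
    clone_generated F u -> clone_generated F f ->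
  clone_generated F (fun x => u [tuple f x]).
Proof.
move=> cu cf.
apply: (eq_clone _ (clone_substitution (g := fun=> f) cu _)) => // x.
by congr u; apply: eq_from_tnth => i; rewrite (ord1 i) tnth_mktuple.
Qed.

Lemma clone_app2 (A I : Type) (ar : I -> nat)
    (F : forall i : I, operation A (ar i)) (b : operation A 2)
    k (f g : operation A k) :
    clone_generated F b -> clone_generated F f -> clone_generated F g ->
  clone_generated F (fun x => b [tuple f x; g x]).
Proof.
move=> cb cf cg; pose h (i : 'I_2) := if i == ord0 then f else g.
have ch i : clone_generated F (h i) by rewrite /h; case: ifP.
apply: (eq_clone _ (clone_substitution cb ch)) => // x.
congr b; apply: eq_from_tnth => -[[|[|i]] lti] //; rewrite tnth_mktuple /h //.
Qed.

Lemma clone_tnth (A I : Type) (ar : I -> nat)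
    (F : forall i : I, operation A (ar i)) k (i : 'I_k) :
  clone_generated F (fun x : k.-tuple A => tnth x i).
Proof. exact: (@clone_proj _ _ _ _ _ _ i). Qed.

Lemma clone_cst (A I : Type) (ar : I -> nat)
    (F : forall i : I, operation A (ar i)) (c : A) k :
    clone_generated F (fun _ : 1.-tuple A => c) -> (0 < k)%N ->
  clone_generated F (fun _ : k.-tuple A => c).
Proof.
case: k => // k cc _.
by apply: (clone_app1 (f := fun x => tnth x ord0) cc); apply: clone_tnth.
Qed.

Section AdditiveClones.

Variables (A : finZmodType) (I : Type) (ar : I -> nat).
Variable F : forall i : I, operation A (ar i).
Hypothesis addF :
  clone_generated F (fun x : 2.-tuple A => tnth x ord0 + tnth x ord_max).
Hypothesis zeroF : clone_generated F (fun _ : 1.-tuple A => 0).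

Lemma clone_addr k (f g : operation A k) :
    clone_generated F f -> clone_generated F g ->
  clone_generated F (fun x => f x + g x).
Proof. by move=> cf cg; apply: (clone_app2 addF cf cg). Qed.

Let clone_zero k : (0 < k)%N -> clone_generated F (fun _ : k.-tuple A => 0).
Proof. exact: clone_cst. Qed.

Lemma clone_mulrn k (f : operation A k) n : (0 < k)%N ->
  clone_generated F f -> clone_generated F (fun x => f x *+ n).
Proof.
move=> k_gt0 cf; elim: n => [|n IHn]; first exact: clone_zero.
by apply: (eq_clone _ (clone_addr cf IHn)) => x; rewrite mulrS.
Qed.

(** In a finite group the opposite is a multiple. *)
Lemma clone_oppr k (f : operation A k) : (0 < k)%N ->
  clone_generated F f -> clone_generated F (fun x => - f x).
Proof.
move=> k_gt0 /(clone_mulrn #|A|.-1 k_gt0); apply: eq_clone => x.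
apply/esym/eqP; rewrite eq_sym -addr_eq0 -mulrSr prednK; last first.
  by apply/card_gt0P; exists 0.
by rewrite -zmodXgE -order_dvdn -cardsT order_dvdG ?inE.
Qed.

Lemma clone_sum k J (r : seq J) (f : J -> operation A k) : (0 < k)%N ->
    (forall j, clone_generated F (f j)) ->
  clone_generated F (fun x => \sum_(j <- r) f j x).
Proof.
move=> k_gt0 cf; elim: r => [|j r IHr].
  by apply: (eq_clone _ (clone_zero k_gt0)) => x; rewrite big_nil.
by apply: (eq_clone _ (clone_addr (cf j) IHr)) => x; rewrite big_cons.
Qed.

(** The basic operations include a nullary one, which no clone contains; since
    k is positive it can be replaced by a constant operation. *)
Lemma clone_term n (t : operation A n) k (g : 'I_n -> operation A k) :
    (0 < k)%N -> (forall j, clone_generated F (g j)) ->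
    term_function (A := group_algebra A) t ->
  clone_generated F (fun x => t [tuple g j x | j < n]).
Proof.
move=> k_gt0 cg; elim=> {t} [t j tE|t s e _ IHe tE].
  by apply: (eq_clone _ (cg j)) => x; rewrite tE tnth_mktuple.
case: s e IHe tE => e IHe tE.
- by apply: (eq_clone _ (clone_zero k_gt0)) => x; rewrite tE.
- apply: (eq_clone _ (clone_oppr k_gt0 (IHe ord0))) => x.
  by rewrite tE /= tnth_mktuple.
- apply: (eq_clone _ (clone_addr (IHe ord0) (IHe ord_max))) => x.
  by rewrite tE /= !tnth_mktuple.
Qed.

End AdditiveClones.

Lemma compatible_add (A : finZmodType) :
  coordinate_compatible (fun x : 2.-tuple A => tnth x ord0 + tnth x ord_max).
Proof.
move=> x i u; rewrite !tnth_tset opprD addrACA.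
have [->|->] : i = ord0 \/ i = ord_max.
- by case: i => [[|[|i]] lti] //; [left | right]; apply: val_inj.
- by rewrite /= subrr addr0 cycle_id.
- by rewrite /= subrr add0r cycle_id.
Qed.

Lemma affine_complete_fg (A : finZmodType) :
    affine_complete (group_algebra A) ->
  finitely_generated (@Comp (group_algebra A)).
Proof.
move=> acA.
pose ar (i : option A) := if i is Some _ then 1%N else 2.
pose F (i : option A) : operation A (ar i) :=
  match i with
  | Some c => fun=> c
  | None => fun x => tnth x ord0 + tnth x ord_max
  end.
have addF := clone_generator F None.
have cstF c := clone_generator F (Some c).
apply: (@finitely_generated_fin _ _ _ ar F) => [[c|]|k f Cf].
- by apply/CompP; split=> // x i u; rewrite subrr group1.
- by apply/CompP; split=> //; apply: compatible_add.
have [k_gt0 _] := Cf; have [l [a [t [tt fE]]]] := acA k f Cf.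
pose g (j : 'I_(k + l)) : operation A k :=
  fun x => match split j with inl i => tnth x i | inr i => tnth a i end.
have cg j : clone_generated F (g j).
  rewrite /g; case: (split j) => i; first exact: clone_tnth.
  exact: clone_cst (cstF _) k_gt0.
apply: (eq_clone _ (clone_term addF (cstF 0) k_gt0 cg tt)) => x.
rewrite fE; congr t; apply: eq_from_tnth => j; rewrite tnth_mktuple /g.
case: splitP => i ji.
  by rewrite (_ : j = lshift l i) ?tnth_lshift //; apply: val_inj.
by rewrite (_ : j = rshift k i) ?tnth_rshift //; apply: val_inj.
Qed.

(** * Compatible functions *)

Lemma switch_compatible (A : finZmodType) k (T : k.-tuple A -> bool) (c : A) :
    (forall x i u, T (tset x i u) != T x -> c \in <[u - tnth x i]>%g) ->
  coordinate_compatible (fun x => if T x then c else 0).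
Proof.
move=> cT x i u; have := cT x i u.
case: (T (tset x i u)); case: (T x) => cu.
- by rewrite subrr mem0_cycle.
- by rewrite subr0 cu.
- by rewrite sub0r oppr_cycle cu.
- by rewrite subr0 mem0_cycle.
Qed.

Lemma compatible_addr (A : finZmodType) k (f g : operation A k) :
    coordinate_compatible f -> coordinate_compatible g ->
  coordinate_compatible (fun x => f x + g x).
Proof.
by move=> cf cg x i u; rewrite opprD addrACA addr_cycle // ?cf ?cg.
Qed.

Lemma compatible_mulrn (A : finZmodType) k (f : operation A k) n :
  coordinate_compatible f -> coordinate_compatible (fun x => f x *+ n).
Proof. by move=> cf x i u; rewrite -mulrnBl mulrn_in_cycle. Qed.

Lemma compatible_oppr (A : finZmodType) k (f : operation A k) :
  coordinate_compatible f -> coordinate_compatible (fun x => - f x).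
Proof. by move=> cf x i u; rewrite -opprD oppr_cycle. Qed.

Lemma compatible_cst (A : finZmodType) k (c : A) :
  coordinate_compatible (fun _ : k.-tuple A => c).
Proof. by move=> x i u; rewrite subrr mem0_cycle. Qed.

Lemma compatible_tnth (A : finZmodType) k (j : 'I_k) :
  coordinate_compatible (fun x : k.-tuple A => tnth x j).
Proof.
move=> x i u; rewrite tnth_tset.
by case: eqP => [->|_]; [rewrite cycle_id | rewrite subrr mem0_cycle].
Qed.

Lemma compatible_sum (A : finZmodType) k n (f : 'I_n -> operation A k) :
    (forall j, coordinate_compatible (f j)) ->
  coordinate_compatible (fun x => \sum_j f j x).
Proof.
move=> cf x i u; rewrite -sumrB.
apply: (big_ind (fun v => v \in <[u - tnth x i]>%g)) => [|v w|j _].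
- exact: mem0_cycle.
- exact: addr_cycle.
- exact: cf.
Qed.

(** The elements killed by q form a subgroup, and f preserves the congruence
    that belongs to it. *)
Lemma compatible_torsion (A : finZmodType) k (f : operation A k) q x y :
    coordinate_compatible f -> (forall i, (tnth x i - tnth y i) *+ q = 0) ->
  (f x - f y) *+ q = 0.
Proof.
move=> cf xy.
apply: (coordinatewise_ind (y := y) (Q := fun z => (f z - f y) *+ q = 0))
  => [|z i zi IHz].
  by rewrite subrr mul0rn.
rewrite -(subrK (f z) (f _)) -addrA mulrnDl IHz addr0.
have /mem_cycleP[m ->] := cf z i (tnth x i).
by rewrite mulrnAC zi xy mul0rn.
Qed.

(** * Cyclic p-groups *)

Section CyclicPGroups.

Variables (A : finZmodType) (p n : nat) (g : A).
Implicit Types (u v : A).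
Hypotheses (p_pr : prime p) (genA : <[g]>%g = [set: A]).
Hypothesis cardA : #|A| = (p ^ n)%N.

Let order_g : #[g]%g = (p ^ n)%N.
Proof. by rewrite orderE genA cardsT. Qed.

Let mulrn_g m : (g *+ m == 0) = (p ^ n %| m)%N.
Proof. by rewrite -order_g order_dvdn. Qed.

Let mulrn_gP u : exists m, u = g *+ m.
Proof. by apply/mem_cycleP; rewrite genA inE. Qed.

(** An element outside p^(i+1) A, which is the kernel of multiplication by
    p^(n-i-1), generates a subgroup containing p^i A: the subgroups of A form a
    chain. *)
Lemma cyclic_subgroups_chain i (u : A) : (i < n)%N ->
  u *+ p ^ (n - i.+1) != 0 -> g *+ p ^ i \in <[u]>%g.
Proof.
move=> ltin; have [m ->] := mulrn_gP u; rewrite -mulrnA mulrn_g.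
have [->|m_gt0] := posnP m; first by rewrite mul0n dvdn0.
have [m' com' ->] := pfactor_coprime p_pr m_gt0; set l := logn p m.
have [lel _|ltil /negP[]] := leqP l i; last first.
  by rewrite -mulnA -expnD dvdn_mull // dvdn_exp2l // -leq_subLR leq_sub2l.
have -> : <[g *+ (m' * p ^ l)]>%g = <[g *+ p ^ l]>%g.
  apply/esym/eqP; rewrite [in X in _ == X]mulnC mulrnA -zmodXgE.
  rewrite -[_ == _]/(generator _ _) generator_coprime.
  have : #[g *+ p ^ l]%g %| p ^ n by rewrite -order_g orderXdvd.
  by move/coprime_dvdl; apply; rewrite coprimeXl.
by rewrite -(subnKC lel) expnD mulrnA mulrn_cycle.
Qed.

Let c i := g *+ p ^ i.
(* Congruence to 0 modulo p^(i+1) A. *)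
Let near_cond i (x : A) := x *+ p ^ (n - i.+1) == 0.

(** Nesting this operation in its second argument turns conditions on single
    variables modulo p^(i+1) A into their conjunction. *)
Definition digit_product i : operation A 2 := fun x =>
  if near_cond i (tnth x ord0) && near_cond i (tnth x ord_max - c i)
  then c i else 0.

Let near_chain i (u v : A) : (i < n)%N ->
  near_cond i u != near_cond i v -> c i \in <[u - v]>%g.
Proof.
move=> ltin neq; apply: cyclic_subgroups_chain => //.
apply: contra neq => /eqP uv0; rewrite /near_cond.
by rewrite -(subrK v u) mulrnDl uv0 add0r.
Qed.

Lemma digit_product_compatible i : (i < n)%N ->
  coordinate_compatible (digit_product i).
Proof.
move=> ltin; apply: switch_compatible => x j u; rewrite !tnth_tset.
have [->|->] : j = ord0 \/ j = ord_max.
- by case: j => [[|[|j]] ltj] //; [left | right]; apply: val_inj.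
- rewrite /= => neq; apply: near_chain => //.
  by apply: contraNneq neq => ->.
rewrite /= => neq.
have -> : u - tnth x ord_max = (u - c i) - (tnth x ord_max - c i).
  by rewrite opprB addrA subrK.
by apply: near_chain => //; apply: contraNneq neq => ->.
Qed.

Section Generation.

Variables (I : Type) (ar : I -> nat) (F : forall i : I, operation A (ar i)).
Hypothesis addF :
  clone_generated F (fun x : 2.-tuple A => tnth x ord0 + tnth x ord_max).
Hypothesis cstF : forall c : A, clone_generated F (fun _ : 1.-tuple A => c).
Hypothesis digF : forall i : 'I_n, clone_generated F (digit_product i).

(* When s lists all places, this is an indicator function of the coset of a
   modulo p^(i+1) A. *)
Let bump i k (a : k.-tuple A) (s : seq 'I_k) (x : k.-tuple A) :=
  if all (fun j => near_cond i (tnth x j - tnth a j)) s then c i else 0.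

Let clone_bump i k (a : k.-tuple A) s : (i < n)%N -> (0 < k)%N ->
  clone_generated F (bump i a s).
Proof.
move=> ltin k_gt0; elim: s => [|j s IHs]; first exact: clone_cst.
have cj : clone_generated F (fun x : k.-tuple A => tnth x j + - tnth a j).
  by apply: (clone_addr addF); [apply: clone_tnth | apply: clone_cst].
apply: (eq_clone _ (clone_app2 (digF (Ordinal ltin)) cj IHs)) => x.
rewrite /digit_product /bump /= /near_cond.
case: (_ == _) => //=; case: (all _ _) => /=.
  by rewrite subrr mul0rn eqxx.
apply: ifN; rewrite sub0r mulNrn oppr_eq0 /c -mulrnA mulrn_g -expnD.
by rewrite dvdn_Pexp2l ?prime_gt1 // -ltnNge -addSn subnKC.
Qed.

Let bump_compatible i k (a : k.-tuple A) s : (i < n)%N ->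
  coordinate_compatible (bump i a s).
Proof.
move=> ltin; apply: switch_compatible => x j u neq.
have : near_cond i (u - tnth a j) != near_cond i (tnth x j - tnth a j).
  apply: contraNneq neq => eq_near; apply/eqP/eq_all => l.
  by rewrite tnth_tset; case: eqP => // ->.
by move/(near_chain ltin); rewrite opprB addrA subrK.
Qed.

Let values_in_level i (u : A) : (i < n)%N -> u *+ p ^ (n - i) = 0 ->
  exists l, u = c i *+ l.
Proof.
move=> ltin; have [m ->] := mulrn_gP u; rewrite -mulrnA => /eqP.
rewrite mulrn_g -{1}(subnKC (ltnW ltin)) expnD dvdn_pmul2r; last first.
  by rewrite expn_gt0 prime_gt0.
by case/dvdnP=> l ->; exists l; rewrite mulnC mulrnA.
Qed.

(** Induction on d = n - i, for functions with values in p^i A, the kernel of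
    multiplication by p^d.  Such a function is constant modulo p^(i+1) A on
    cosets, so subtracting a multiple of a bump makes it vanish modulo p^(i+1) A
    on one coset and leaves it unchanged elsewhere: the number of tuples with
    value outside p^(i+1) A decreases. *)
Lemma cyclic_generation k (f : operation A k) : (0 < k)%N ->
  coordinate_compatible f -> clone_generated F f.
Proof.
move=> k_gt0.
suff gen d : forall h : operation A k, (d <= n)%N -> coordinate_compatible h ->
    (forall x, h x *+ p ^ d = 0) -> clone_generated F h.
  move=> cf; apply: (gen n) => // x; have [m ->] := mulrn_gP (f x).
  by apply/eqP; rewrite -mulrnA mulrn_g dvdn_mull.
elim: d => [|d IHd] h led ch h0.
  apply: (eq_clone _ (clone_cst (cstF 0) k_gt0)) => x.
  by rewrite -(h0 x) mulr1n.
have [i ltin di] : exists2 i, (i < n)%N & (n - i)%N = d.+1.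
  by exists (n - d.+1)%N; rewrite ?subKn // ltn_subrL (leq_trans _ led).
have di1 : (n - i.+1)%N = d by rewrite subnS di.
have c0 : c i *+ p ^ (n - i) = 0.
  by apply/eqP; rewrite -mulrnA mulrn_g -expnD subnKC ?(ltnW ltin).
have [m] := ubnP #|[set x | h x *+ p ^ d != 0]|.
elim: m h ch h0 => // m IHm h ch h0 /ltnSE lem.
have [/setP bad0|[a]] := set_0Vmem [set x | h x *+ p ^ d != 0].
  apply: IHd (ltnW led) ch _ => x.
  by have := bad0 x; rewrite !inE => /negbFE/eqP.
rewrite inE => bad_a.
have [l hal] : exists l, h a = c i *+ l.
  by apply: (values_in_level ltin); rewrite di.
pose b := bump i a (enum 'I_k).
have bE x :
    b x = if [forall j, near_cond i (tnth x j - tnth a j)] then c i else 0.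
  rewrite /b /bump; congr (if _ then _ else _).
  apply/allP/forallP => [nx j|nx j _] //.
  by apply: nx; rewrite mem_enum.
have near_h x : [forall j, near_cond i (tnth x j - tnth a j)] ->
    (h x - h a) *+ p ^ d = 0.
  move/forallP=> nx; apply: compatible_torsion => // j; apply/eqP; rewrite -di1.
  exact: nx.
have cb : clone_generated F (fun x => b x *+ l).
  by apply: (clone_mulrn addF (cstF 0)) => //; apply: clone_bump.
suff ch' : clone_generated F (fun x => h x - b x *+ l).
  by apply: (eq_clone _ (clone_addr addF ch' cb)) => x; rewrite subrK.
apply: IHm.
- apply: compatible_addr => //; apply: compatible_oppr; apply: compatible_mulrn.
  exact: bump_compatible.
- move=> x; rewrite mulrnBl h0 sub0r mulrnAC bE.
  apply/eqP; rewrite oppr_eq0; case: ifP => _; rewrite ?mul0rn //.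
  by rewrite -di c0 mul0rn.
apply: leq_trans lem; apply/proper_card/properP; split; last first.
  exists a; rewrite !inE // bE.
  have -> : [forall j, near_cond i (tnth a j - tnth a j)].
    by apply/forallP => j; rewrite /near_cond subrr mul0rn.
  by rewrite -hal subrr mul0rn eqxx.
apply/subsetP => x; rewrite !inE bE; case: ifP => [/near_h|_].
  by rewrite -hal => ->; rewrite eqxx.
by rewrite mul0rn subr0.
Qed.

End Generation.

End CyclicPGroups.

Lemma cyclic_pgroup_fg (A : finZmodType) p :
    prime p -> (p.-group [set: A])%g -> cyclic [set: A] ->
  finitely_generated (@Comp (group_algebra A)).
Proof.
move=> p_pr pA /cyclicP[g defA].
have [n cardA] := p_natP pA; rewrite cardsT in cardA.
pose ar (i : 'I_n + option A) := if i is inr (Some _) then 1%N else 2.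
pose F (i : 'I_n + option A) : operation A (ar i) :=
  match i return operation A (ar i) with
  | inl i => digit_product p n g i
  | inr (Some c) => fun=> c
  | inr None => fun x => tnth x ord0 + tnth x ord_max
  end.
apply: (@finitely_generated_fin _ _ _ ar F) => [[i|[c|]]|k f /CompP[k_gt0 cf]].
- apply/CompP; split=> //.
  exact: (digit_product_compatible p_pr (esym defA) cardA (ltn_ord i)).
- by apply/CompP; split=> // x i u; rewrite subrr group1.
- by apply/CompP; split=> //; apply: compatible_add.
apply: (cyclic_generation p_pr (esym defA) cardA _ _ _ k_gt0 cf).
- exact: (clone_generator F (inr None)).
- by move=> c; apply: (clone_generator F (inr (Some c))).
- by move=> i; apply: (clone_generator F (inl i)).
Qed.
(** * Maps between abelian p-groups have bounded degree *)

Fixpoint degree_lt (B A : zmodType) d (phi : B -> A) : Prop :=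
  if d is d'.+1 then forall x, degree_lt d' (fun b => phi (b + x) - phi b)
  else forall b, phi b = 0.

Lemma eq_degree_lt (B A : zmodType) d (phi psi : B -> A) :
  phi =1 psi -> degree_lt d phi -> degree_lt d psi.
Proof.
elim: d phi psi => [|d IHd] phi psi eq_phi /= dphi.
  by move=> b; rewrite -eq_phi.
by move=> x; apply: IHd (dphi x) => b; rewrite !eq_phi.
Qed.

Section WreathProduct.

Variables (A B : finZmodType).
Implicit Types (x : B) (phi : {ffun B -> A}).

(** The permutations (b, a) |-> (b + x, a + phi b) form the wreath product of A
    and B.  It is a p-group, hence nilpotent, and taking a difference of phi is
    taking a commutator with a translation. *)
Definition affine_shift x phi (u : B * A) : B * A := (u.1 + x, u.2 + phi u.1).

Lemma affine_shift_inj x phi : injective (affine_shift x phi).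
Proof. by move=> [b a] [b' a'] [/addIr-> /addIr->]. Qed.

Definition wreath x phi : {perm B * A} := perm (@affine_shift_inj x phi).

Lemma wreathE x phi u : wreath x phi u = (u.1 + x, u.2 + phi u.1).
Proof. by rewrite permE. Qed.

Definition wreath_set := [set wreath t.1 t.2 | t : B * {ffun B -> A}].

Lemma wreathM x phi y psi :
  (wreath x phi * wreath y psi)%g
    = wreath (x + y) [ffun b => phi b + psi (b + x)].
Proof. by apply/permP=> u; rewrite permM !wreathE /= ffunE !addrA. Qed.

Lemma group_set_wreath : group_set wreath_set.
Proof.
apply/group_setP; split=> [|_ _ /imsetP[[x phi] _ ->] /imsetP[[y psi] _ ->]].
  apply/imsetP; exists (0, [ffun=> 0]) => //; apply/permP=> u.
  by rewrite wreathE perm1 /= ffunE !addr0 -surjective_pairing.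
by rewrite wreathM; apply/imsetP; eexists (_, _).
Qed.

Definition wreath_group := Group group_set_wreath.

Lemma wreath_inj : injective (fun t : B * {ffun B -> A} => wreath t.1 t.2).
Proof.
move=> [x phi] [y psi] /= eq_w.
have w0 b : (b + x, phi b) = (b + y, psi b).
  by move/permP/(_ (b, 0)): eq_w; rewrite !wreathE /= !add0r.
by congr (_, _); [case: (w0 0) => /addrI | apply/ffunP=> b; case: (w0 b)].
Qed.

Lemma pgroup_wreath p :
  (p.-group [set: A])%g -> (p.-group [set: B])%g -> (p.-group wreath_group)%g.
Proof.
rewrite /pgroup !cardsT => pA pB.
rewrite card_imset ?card_prod ?card_ffun ?pnatM ?pnatX ?pA ?pB //.
exact: wreath_inj.
Qed.

(** Conjugation by the translation by -x turns phi into b |-> phi (b + x). *)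
Lemma commutator_wreath x phi :
  [~ wreath 0 phi, wreath (- x) [ffun=> 0]]%g
    = wreath 0 [ffun b => phi (b + x) - phi b].
Proof.
apply: (mulgI (wreath 0 phi)); rewrite commgEl mulKVg.
apply: (mulgI (wreath (- x) [ffun=> 0])).
rewrite !mulgA mulgV mul1g !wreathM; apply/permP=> u.
rewrite !wreathE /= !ffunE.
by rewrite !(add0r, addr0) subrK (addrC (phi (u.1 - x))) subrK.
Qed.

End WreathProduct.

(** D-fold differences are D-fold commutators in the wreath product, and thus
    vanish when D reaches its nilpotency class. *)
Lemma bounded_degree (A B : finZmodType) (p : nat) :
    (p.-group [set: A])%g -> (p.-group [set: B])%g ->
  exists D, forall phi : B -> A, degree_lt D phi.
Proof.
move=> pA pB; pose W := wreath_group A B.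
have nilW := pgroup_nil (pgroup_wreath pA pB).
have [n Ln] : exists n, 'L_n.+1(W)%g = 1%g.
  by exists (nil_class W); apply/lcn_nil_classP.
have inW x phi : wreath x phi \in W by apply/imsetP; exists (x, phi).
exists n => phi.
apply: (@eq_degree_lt _ _ _ (finfun phi)) => [b|]; first exact: ffunE.
suff main d psi : (d <= n)%N -> wreath 0 psi \in 'L_(n.+1 - d)(W)%g ->
    degree_lt d psi by apply: main; rewrite // subSnn lcn1.
elim: d psi => [|d IHd] {}phi led /= Lphi.
  move=> b; move: Lphi; rewrite subn0 Ln => /set1gP/permP/(_ (b, 0)).
  by rewrite wreathE perm1 /= add0r => -[].
move=> x; apply: (@eq_degree_lt _ _ _ [ffun b => phi (b + x) - phi b]) => [b|].
  by rewrite ffunE.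
apply: IHd (ltnW led) _; rewrite subSn ?(ltnW led) // -(subnSK led) lcnSn.
by rewrite -commutator_wreath mem_commg ?inW // subnSK // -subSS.
Qed.

(** * Sums of functions of few variables *)

Definition depends_on (A T : Type) k (S : {set 'I_k}) (f : k.-tuple A -> T) :=
  forall x y : k.-tuple A,
  (forall i, i \in S -> tnth x i = tnth y i) -> f x = f y.

(** Building the sum one summand at a time gives the induction that is needed
    for compositions. *)
Inductive few_variables (A : Type) (T : zmodType) k d :
    (k.-tuple A -> T) -> Prop :=
| FewZero f : f =1 (fun=> 0) -> few_variables d f
| FewAdd f g h (S : {set 'I_k}) : depends_on S g -> (#|S| <= d)%N ->
    few_variables d h -> f =1 (fun x => h x + g x) -> few_variables d f.

Section FewVariables.

Variables (A : Type) (T : zmodType) (k : nat).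
Implicit Types (f g h : k.-tuple A -> T).

Lemma eq_few_variables d f g :
  f =1 g -> few_variables d f -> few_variables d g.
Proof.
move=> eqfg ff; case: f / ff eqfg => [f f0|f h1 h2 S Sh leSd fh2 fE] eqfg.
  by apply: FewZero => x; rewrite -eqfg f0.
by apply: (FewAdd Sh leSd fh2) => x; rewrite -eqfg fE.
Qed.

Lemma few_variablesS d d' f :
  (d <= d')%N -> few_variables d f -> few_variables d' f.
Proof.
move=> led; elim=> {f} [f f0|f g h S Sg leSd _ fh fE]; first exact: FewZero.
exact: FewAdd Sg (leq_trans leSd led) fh fE.
Qed.

Lemma few_variables_dep d f (S : {set 'I_k}) :
  depends_on S f -> (#|S| <= d)%N -> few_variables d f.
Proof.
move=> Sf leSd; apply: (FewAdd Sf leSd (h := fun=> 0)); first exact: FewZero.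
by move=> x; rewrite add0r.
Qed.

Lemma few_variables_cst d c : few_variables d (fun _ : k.-tuple A => c : T).
Proof. by apply: (@few_variables_dep _ _ set0) => //; rewrite cards0. Qed.

Lemma few_variablesD d f g :
    few_variables d f -> few_variables d g ->
  few_variables d (fun x => f x + g x).
Proof.
move=> ff fg; elim: ff => {f} [f f0|f g' h S Sg' leSd _ fh fE].
  by apply: eq_few_variables fg => x; rewrite f0 add0r.
by apply: (FewAdd Sg' leSd fh) => x; rewrite fE addrAC.
Qed.

Lemma few_variables_sum d J (r : seq J) (f : J -> k.-tuple A -> T) :
    (forall j, few_variables d (f j)) ->
  few_variables d (fun x => \sum_(j <- r) f j x).
Proof.
move=> ff; elim: r => [|j r IHr].
  by apply: FewZero => x; rewrite big_nil.
by apply: eq_few_variables (few_variablesD (ff j) IHr) => x; rewrite big_cons.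
Qed.

Lemma few_variables_mulrn d f n :
  few_variables d f -> few_variables d (fun x => f x *+ n).
Proof.
move=> ff.
apply: eq_few_variables (few_variables_sum (iota 0 n) (fun=> ff)) => x.
by rewrite big_const_seq count_predT size_iota iter_addr_0.
Qed.

End FewVariables.

Lemma few_variables_map (A : Type) (T U : zmodType) k d (f : k.-tuple A -> T)
    (phi : T -> U) : {morph phi : x y / x + y} ->
  few_variables d f -> few_variables d (phi \o f).
Proof.
move=> phiD.
have phi0 : phi 0 = 0 by apply: (addrI (phi 0)); rewrite -phiD !addr0.
elim=> {f} [f f0|f g h S Sg leSd _ fh fE].
  by apply: FewZero => x; rewrite /= f0.
apply: (FewAdd (g := phi \o g) _ leSd fh) => [x y xy|x] /=.
  by congr phi; apply: Sg.
by rewrite fE phiD.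
Qed.

(** Peel off the summands g of t by
      Phi (h + g) = Phi h + (Phi (h + g) - Phi h).
    The second term is a map of smaller degree applied to h, but it depends on
    the variables of g as well; this is why Phi may depend on variables in
    W. *)
Lemma few_variables_comp (A : Type) (B T : zmodType) k d D
    (t : k.-tuple A -> B) (W : {set 'I_k}) (Phi : k.-tuple A -> B -> T) :
    few_variables d t ->
    (forall b, depends_on W (Phi^~ b)) -> (forall x, degree_lt D (Phi x)) ->
  few_variables (#|W| + D * d) (fun x => Phi x (t x)).
Proof.
move=> ft.
elim: ft D W Phi => {t} [t t0|t g h S Sg leSd _ IHh tE] D W Phi WPhi DPhi.
  apply: (@few_variables_dep _ _ _ _ _ W); last exact: leq_addr.
  by move=> x y xy; rewrite !t0; apply: WPhi.
case: D DPhi => [|D] DPhi; first by apply: FewZero => x; apply: DPhi.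
pose Psi x b := Phi x (b + g x) - Phi x b.
have WPsi b : depends_on (W :|: S) (Psi^~ b).
  move=> x y xy; rewrite /Psi.
  have -> : g x = g y by apply: Sg => i iS; apply: xy; rewrite inE iS orbT.
  by congr (_ - _); apply: WPhi => i iW; apply: xy; rewrite inE iW.
have few1 := IHh D.+1 W Phi WPhi DPhi.
have few2 := IHh D _ Psi WPsi (fun x => DPhi x (g x)).
apply: (@eq_few_variables _ _ _ _ (fun x => Phi x (h x) + Psi x (h x))) => [x|].
  by rewrite /Psi addrC subrK tE.
apply: few_variablesD few1 (few_variablesS _ few2).
by rewrite mulSn addnA leq_add2r (leq_trans (leq_card_setU _ _)) // leq_add2l.
Qed.

Lemma few_variables_ffun (A : Type) (T : zmodType) k d R
    (t : 'I_R -> k.-tuple A -> T) :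
    (forall l, few_variables d (t l)) ->
  few_variables d (fun x => [ffun l => t l x]).
Proof.
move=> ft.
pose inj l (u : T) : {ffun 'I_R -> T} :=
  [ffun l' => if l' == l then u else 0].
have injD l : {morph inj l : u v / u + v}.
  by move=> u v; apply/ffunP=> l'; rewrite !ffunE; case: eqP; rewrite ?addr0.
apply: eq_few_variables (few_variables_sum (index_enum _)
  (fun l => few_variables_map (injD l) (ft l))) => x.
apply/ffunP=> l.
rewrite sum_ffunE ffunE (bigD1 l) //= ffunE eqxx big1 ?addr0 //.
by move=> l' /negPf nl; rewrite ffunE eq_sym nl.
Qed.

(** The alternating sum over the vertices of a k-dimensional cube vanishes on
    functions that ignore some variable, because the vertices cancel in pairs
    along that direction. *)
Section AlternatingSum.

Variables (A : Type) (T : zmodType) (k : nat) (e0 e1 : A).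

Definition vertex (S : {set 'I_k}) :=
  [tuple if i \in S then e1 else e0 | i < k].
Definition signed (S : {set 'I_k}) (u : T) := if odd #|S| then - u else u.
Definition alternating (f : k.-tuple A -> T) := \sum_S signed S (f (vertex S)).

Lemma alternating_depends f (S : {set 'I_k}) :
  depends_on S f -> (#|S| < k)%N -> alternating f = 0.
Proof.
move=> Sf ltSk; have [i iS] : exists i, i \notin S.
  apply/existsP; rewrite -negb_forall; apply: contraL ltSk => /forallP allS.
  by rewrite -leqNgt -{1}(card_ord k) -cardsT subset_leq_card //; apply/subsetP.
rewrite /alternating (bigID (fun U : {set 'I_k} => i \in U)) /=.
rewrite (reindex_onto (fun U => i |: U) (fun U => U :\ i))
  => [|U iU] /=; last exact: setD1K.
rewrite [X in X + _](eq_bigl (fun U : {set 'I_k} => i \notin U))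
  => [|U]; last first.
  rewrite setU11 /=; apply/eqP/idP => [<-|]; first by rewrite !inE eqxx.
  exact: setU1K.
rewrite -big_split /= big1 // => U iU; rewrite /signed cardsU1 iU /=.
have -> : f (vertex (i |: U)) = f (vertex U).
  apply: Sf => j jS; rewrite !tnth_mktuple !inE; case: eqP => // ji.
  by rewrite -ji jS in iS.
by case: (odd _); rewrite /= ?subrr ?addNr.
Qed.

Lemma alternating_few_variables d f :
  few_variables d f -> (d < k)%N -> alternating f = 0.
Proof.
move=> ff ltdk; elim: ff => {f} [f f0|f g h S Sg leSd _ h0 fE].
  by rewrite /alternating big1 // => U _; rewrite f0 /signed oppr0 if_same.
transitivity (alternating h + alternating g); last first.
  by rewrite h0 (alternating_depends Sg) ?addr0 // (leq_ltn_trans leSd).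
rewrite -big_split; apply: eq_bigr => U _; rewrite fE /signed.
by case: ifP; rewrite // opprD.
Qed.

End AlternatingSum.

(** * The obstruction to finite generation *)

HB.instance Definition _ (I : finType) (A : finZmodType) :=
  GRing.Zmodule.on {ffun I -> A}.

(** This is what lets approximations gain one power of p at each application of
    a generator. *)
Definition lifting_by (A : finZmodType) (p : nat) k (h : operation A k) :=
  forall j x y, (forall i, exists v, tnth x i - tnth y i = v *+ p ^ j) ->
  exists v, h x - h y = v *+ p ^ j.+1.

Definition splits_off_affine (A : finZmodType) (p : nat) k
    (f : operation A k) :=
  exists (c0 : A) (c : 'I_k -> nat) (h : operation A k),
    lifting_by p h /\ forall x, f x = c0 + \sum_i tnth x i *+ c i + h x.

Lemma pgroup_ffun (A : finZmodType) (p R : nat) :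
  (p.-group [set: A])%g -> (p.-group [set: {ffun 'I_R -> A}])%g.
Proof. by rewrite /pgroup !cardsT card_ffun pnatX => ->. Qed.

Section Obstruction.

Variables (A : finZmodType) (p : nat).
Hypothesis pA : (p.-group [set: A])%g.

Definition few_mod d m k (f : operation A k) :=
  exists2 s, few_variables d s & forall x, exists v, f x = s x + v *+ p ^ m.

Let few_modD d m k (f g : operation A k) :
  few_mod d m f -> few_mod d m g -> few_mod d m (fun x => f x + g x).
Proof.
move=> [s fs sE] [t ft tE].
exists (fun x => s x + t x); first exact: few_variablesD.
move=> x; have [v ->] := sE x; have [w ->] := tE x; exists (v + w).
by rewrite mulrnDl addrACA.
Qed.

Let few_mod_few d m k (s : operation A k) : few_variables d s -> few_mod d m s.
Proof. by exists s => // x; exists 0; rewrite mul0rn addr0. Qed.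

Let few_mod_mulrn d m k (f : operation A k) n :
  few_mod d m f -> few_mod d m (fun x => f x *+ n).
Proof.
move=> [s fs sE]; exists (fun x => s x *+ n); first exact: few_variables_mulrn.
by move=> x; have [v ->] := sE x; exists (v *+ n); rewrite mulrnDl mulrnAC.
Qed.

Let few_mod_sum d m k n (f : 'I_n -> operation A k) :
  (forall j, few_mod d m (f j)) -> few_mod d m (fun x => \sum_j f j x).
Proof.
move=> ff; elim: (index_enum _) => [|j r [s fs sE]].
  exists (fun=> 0); first exact: few_variables_cst.
  by move=> x; exists 0; rewrite big_nil mul0rn addr0.
have [t ft tE] := few_modD (ff j) (ex_intro2 _ _ s fs sE).
by exists t => // x; have [v vE] := tE x; exists v; rewrite big_cons vE.
Qed.

(** Induction on a, then on the generation of f.  The affine part of a generator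
    preserves sums of functions of few variables.  By the lifting property its
    remainder h may be applied to approximations modulo p^a A, at the cost of
    an error in p^(a+1) A; the approximations are sums of functions of at most
    d variables, and h has degree less than D. *)
Lemma bounded_variables (m : nat) (ar : 'I_m -> nat)
    (F : forall i, operation A (ar i)) :
    (forall i, splits_off_affine p (F i)) ->
  forall a, exists d, forall k (f : operation A k),
    clone_generated F f -> few_mod d a f.
Proof.
move=> splitF; pose R := \max_i ar i.
have [D degD] := bounded_degree pA (B := {ffun 'I_R -> A}) (pgroup_ffun R pA).
elim=> [|a [d IHd]].
  exists 0%N => k f _; exists (fun=> 0); first exact: few_variables_cst.
  by move=> x; exists (f x); rewrite add0r expn0.
exists (maxn 1 (D * d)) => k f; elim=> {f} [f j fE|f i g cg IHg fE].
  apply: few_mod_few; apply: (few_variablesS (leq_maxl _ _)).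
  apply: (few_variables_dep (S := [set j])); last by rewrite cards1.
  by move=> x y xy; rewrite !fE xy ?set11.
have [c0 [c [h [hlift FE]]]] := splitF i.
have le_ar : (ar i <= R)%N by apply: leq_bigmax.
have /fin_all_exists2[s fs sE] : forall l, exists2 s,
    few_variables d s & forall x, exists v, g l x = s x + v *+ p ^ a.
  by move=> l; apply: (IHd k _ (cg l)).
(* A single group of R-tuples serves all generators, so that one D works. *)
pose phi (b : {ffun 'I_R -> A}) := h [tuple b (widen_ord le_ar l) | l < ar i].
pose s' (l : 'I_R) : operation A k :=
  if insub (val l) is Some l' then s l' else fun=> 0.
have fs' l : few_variables d (s' l).
  by rewrite /s'; case: insub => [l'|]; [apply: fs | apply: few_variables_cst].
have fphi : few_variables (maxn 1 (D * d)) (fun x => phi [ffun l => s' l x]).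
  apply: (few_variablesS (leq_maxr _ _)).
  rewrite -[(D * d)%N]add0n -(cards0 'I_k).
  exact: (few_variables_comp (Phi := fun=> phi) (few_variables_ffun fs')).
have few_h :
    few_mod (maxn 1 (D * d)) a.+1 (fun x => h [tuple g l x | l < ar i]).
  exists (fun x => phi [ffun l => s' l x]) => // x.
  have [v hE] : exists v, h [tuple g l x | l < ar i]
      - phi [ffun l => s' l x] = v *+ p ^ a.+1.
    apply: hlift => l; rewrite !tnth_mktuple ffunE /s' insubT //= => lt_l.
    rewrite (_ : Sub _ _ = l); last exact: val_inj.
    by have [v ->] := sE l x; exists v; rewrite addrC addKr.
  by exists v; rewrite -hE addrC subrK.
have few_lin : few_mod (maxn 1 (D * d)) a.+1
    (fun x => c0 + \sum_l g l x *+ c l).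
  apply: few_modD; first by apply: few_mod_few; apply: few_variables_cst.
  by apply: few_mod_sum => l; apply: few_mod_mulrn; apply: IHg.
have [t ft tE] := few_modD few_lin few_h.
exists t => // x; have [v vE] := tE x; exists v; rewrite -vE fE FE.
by congr (_ + _ + _); apply: eq_bigr => l _; rewrite tnth_mktuple.
Qed.

(** The exponent of p in the order of A is large enough for the errors in
    bounded_variables to vanish. *)
Lemma not_finitely_generated (e c : A) :
    (forall k (f : operation A k),
       coordinate_compatible f -> splits_off_affine p f) ->
    c != 0 ->
    (forall k, exists2 f : operation A k, coordinate_compatible f &
       forall S, f (vertex 0 e S) = if S == [set: 'I_k] then c else 0) ->
  ~ finitely_generated (@Comp (group_algebra A)).
Proof.
move=> splitA c_neq0 spikes [m [ar [F [CompF genF]]]].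
have splitF i : splits_off_affine p (F i).
  by apply: splitA; have /CompP[] := CompF i.
have [d few_d] := bounded_variables splitF (logn p #|A|).
have [f cf fE] := spikes d.+1.
have [s fs sE] := few_d _ f (genF _ f (proj2 (CompP f) (conj isT cf))).
have : alternating 0 e f = 0.
  apply: (@alternating_few_variables _ _ _ _ _ d) => //.
  apply: eq_few_variables fs => x; have [v ->] := sE x.
  suff -> : v *+ p ^ logn p #|A| = 0 by rewrite addr0.
  apply/eqP; rewrite -zmodXgE -order_dvdn.
  have := order_dvdG (in_setT v); rewrite cardsT.
  by move/dvdn_trans; apply; rewrite -p_part -cardsT part_pnat_id.
rewrite /alternating (bigD1 setT) //= big1 => [|S /negPf neS].
  rewrite addr0 fE eqxx /signed.
  by case: ifP => _ /eqP; rewrite ?oppr_eq0 (negPf c_neq0).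
by rewrite fE neS /signed oppr0 if_same.
Qed.

End Obstruction.

(** * Noncyclic p-groups: compatible functions are almost affine *)

Lemma subrB_cancel (V : zmodType) (a b c u v : V) :
  (a - c - u) - (b - c - v) = (a - b) - (u - v).
Proof.
by rewrite !opprB (addrC v (c - b)) addrACA (addrA (a - c)) subrK (addrC (- u)).
Qed.

Lemma cross_difference (V : zmodType) (a b r a' b' r' : V) :
  (a - b - r) - (a' - b' - r') = r' - r - ((a' - a) - (b' - b)).
Proof. by rewrite !opprB !addrA [LHS](ACl (4*3*5*2*1*6)). Qed.

(** The independence of e1 and e2 modulo p^b is used only through two
    characters with values in Z/p^b that are dual to e1 and e2.  Both vanish
    on p^b A. *)
Section DualPair.

Variables (A : finZmodType) (p b : nat) (e1 e2 : A).
Local Notation q := (p ^ b)%N.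
Variables chi1 chi2 : {additive A -> 'Z_q}.
Hypotheses (p_pr : prime p) (b_gt0 : (0 < b)%N).
Hypotheses (chi11 : chi1 e1 = 1) (chi12 : chi1 e2 = 0).
Hypotheses (chi21 : chi2 e1 = 0) (chi22 : chi2 e2 = 1).

Let q_gt1 : (1 < q)%N.
Proof. by rewrite -(exp1n b) ltn_exp2r ?prime_gt1. Qed.

Lemma Zq_natr_eq0 s : (s%:R == 0 :> 'Z_q) = (q %| s)%N.
Proof. by rewrite -val_eqE /= val_Zp_nat. Qed.

(** Modulo a prime power, each element is a unit times a power of p, so
    divisibility is total. *)
Lemma Zq_chain (x y : 'Z_q) : exists d, y = x * d \/ x = y * d.
Proof.
have decomp (z : 'Z_q) : exists l u, u \is a GRing.unit /\ z = u * p%:R ^+ l.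
  have [->|z_gt0] := eqVneq z 0.
    exists b, 1; rewrite unitr1 mul1r -natrX; split=> //.
    by apply/esym/eqP; rewrite Zq_natr_eq0.
  have z0 : (0 < z)%N by rewrite lt0n.
  have [m com zE] := pfactor_coprime p_pr z0.
  exists (logn p z), m%:R; rewrite unitZpE // coprimeXl //; split=> //.
  by rewrite -natrX -natrM -zE natr_Zp.
have [l [u [uu xE]]] := decomp x; have [m [v [uv yE]]] := decomp y.
have [lelm|/ltnW lelm] := leqP l m.
  exists (u^-1 * v * p%:R ^+ (m - l)); left; rewrite xE yE.
  by rewrite mulrACA (mulrA u) divrr // mul1r -exprD subnKC.
exists (v^-1 * u * p%:R ^+ (l - m)); right; rewrite xE yE.
by rewrite mulrACA (mulrA v) divrr // mul1r -exprD subnKC.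
Qed.

Definition in_qA (u : A) := exists v, u = v *+ q.

Lemma in_qA0 : in_qA 0. Proof. by exists 0; rewrite mul0rn. Qed.

Lemma in_qAD u v : in_qA u -> in_qA v -> in_qA (u + v).
Proof. by move=> [x ->] [y ->]; exists (x + y); rewrite mulrnDl. Qed.

Lemma in_qAN u : in_qA u -> in_qA (- u).
Proof. by move=> [x ->]; exists (- x); rewrite mulNrn. Qed.

Lemma in_qAM u s : (q %| s)%N -> in_qA (u *+ s).
Proof. by case/dvdnP=> t ->; exists (u *+ t); rewrite mulrnA. Qed.

Lemma chi_qA (chi : {additive A -> 'Z_q}) u : in_qA u -> chi u = 0.
Proof. by case=> v ->; rewrite raddfMn -mulr_natr pchar_Zp // mulr0. Qed.

Lemma in_qA_congr u s t : s%:R = t%:R :> 'Z_q -> in_qA (u *+ s - u *+ t).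
Proof.
wlog lest : s t / (t <= s)%N => [IH st|st].
  have [lets|/ltnW lest] := leqP t s; first exact: IH.
  by rewrite -opprB; apply/in_qAN/IH.
rewrite -mulrnBr //; apply: in_qAM.
by rewrite -Zq_natr_eq0 natrB // st subrr.
Qed.

(** Subtract the slope c of phi at e1 to get rho with rho 0 = rho e1 = 0.
    Comparison with e1 shows that rho e2 lies in p^b A, and then comparison
    with 0 and e2 that rho does so at all multiples of e1.  For arbitrary x, the
    multiple of e1 with the same value under chi1 as x gives chi1 (rho x) = 0;
    the next multiple differs from x by an element on which chi1 is -1, and
    this forces rho x into p^b A. *)
Lemma compatible_unary_affine (phi : A -> A) :
    (forall u v, phi u - phi v \in <[u - v]>%g) ->
  exists c, forall u, in_qA (phi u - phi 0 - u *+ c).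
Proof.
move=> cphi.
have [c phi1] : exists c, phi e1 - phi 0 = e1 *+ c.
  by apply/mem_cycleP; rewrite -{2}[e1]subr0.
exists c; pose rho u := phi u - phi 0 - u *+ c.
have crho u v : exists s, rho u - rho v = (u - v) *+ s.
  apply/mem_cycleP; rewrite /rho subrB_cancel -mulrnBl.
  by rewrite addr_cycle ?oppr_cycle ?mulrn_cycle.
have rho0 : rho 0 = 0 by rewrite /rho subrr mul0rn subr0.
have rho1 : rho e1 = 0 by rewrite /rho phi1 subrr.
have [s2 rho2] : exists s, rho e2 = e2 *+ s.
  by have [s] := crho e2 0; rewrite rho0 !subr0; exists s.
have q_s2 : (q %| s2)%N.
  have [t] := crho e2 e1; rewrite rho1 subr0 rho2 => eq_t.
  have := congr1 chi1 eq_t; rewrite !raddfMn raddfB chi11 chi12 sub0r mul0rn.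
  rewrite mulNrn => /esym/eqP; rewrite oppr_eq0 => /eqP t0.
  have := congr1 chi2 eq_t; rewrite !raddfMn raddfB chi21 chi22 subr0 t0.
  by move/eqP; rewrite Zq_natr_eq0.
have rho_e1 a : in_qA (rho (e1 *+ a)).
  have [s] := crho (e1 *+ a) 0; rewrite rho0 !subr0 -mulrnA => sE.
  have [t] := crho (e1 *+ a) e2; rewrite sE rho2 => eq_t.
  have s2_0 : chi2 e2 *+ s2 = 0.
    by rewrite chi22; apply/eqP; rewrite Zq_natr_eq0.
  have := congr1 chi2 eq_t.
  rewrite raddfB !(raddfMn chi2) raddfB (raddfMn chi2) s2_0 chi21 chi22.
  rewrite !mul0rn subr0 sub0r mulNrn => /esym/eqP; rewrite oppr_eq0 => /eqP t0.
  have := congr1 chi1 eq_t.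
  rewrite raddfB !(raddfMn chi1) raddfB (raddfMn chi1).
  rewrite chi11 chi12 mul0rn !subr0.
  rewrite mulrnAC t0 mul0rn => /eqP; rewrite Zq_natr_eq0; apply: in_qAM.
move=> x; rewrite -/(rho x).
have a_chi (a : nat) : a%:R = chi1 (e1 *+ a) by rewrite raddfMn chi11.
have [s sE] := crho x (e1 *+ (chi1 x)).
have [t tE] := crho x (e1 *+ (chi1 x).+1).
have chirho : chi1 (rho x) = 0.
  have := congr1 chi1 sE; rewrite raddfB (chi_qA chi1 (rho_e1 _)) subr0 => ->.
  by rewrite raddfMn raddfB -a_chi natr_Zp subrr mul0rn.
have q_t : (q %| t)%N.
  have := congr1 chi1 tE; rewrite raddfB (chi_qA chi1 (rho_e1 _)) chirho subr0.
  rewrite raddfMn raddfB -a_chi mulrS natr_Zp opprD addrCA subrr addr0.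
  by rewrite mulNrn => /esym/eqP; rewrite oppr_eq0 Zq_natr_eq0.
rewrite -(subrK (rho (e1 *+ (chi1 x).+1)) (rho x)) tE.
by apply: in_qAD (in_qAM _ q_t) (rho_e1 _).
Qed.

Lemma compatible_unary k (f : operation A k) x i : coordinate_compatible f ->
  forall u v, f (tset x i u) - f (tset x i v) \in <[u - v]>%g.
Proof.
by move=> cf u v; have := cf (tset x i v) i u; rewrite tsetK tnth_tset eqxx.
Qed.

(* The cyclic group generated by w cannot contain (c - c') e1 and (c - c') e2
   modulo p^b A unless both vanish there: one of chi1 w and chi2 w divides the
   other. *)
Let slopes_agree (w : A) c c' :
    (forall u, exists m, in_qA (u *+ c - u *+ c' - w *+ m)) ->
  c%:R = c'%:R :> 'Z_q.
Proof.
move=> cc'.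
have eval (chi : {additive A -> 'Z_q}) (e : A) m :
    in_qA (e *+ c - e *+ c' - w *+ m) -> chi e *+ c - chi e *+ c' = chi w *+ m.
  by move/(chi_qA chi)/eqP; rewrite !raddfB !(raddfMn chi) subr_eq0 => /eqP.
have [m1 /[dup] /(eval chi1) + /(eval chi2)] := cc' e1.
have [m2 /[dup] /(eval chi1) + /(eval chi2)] := cc' e2.
rewrite chi11 chi12 chi21 chi22 !mul0rn subrr => e21 e22 e11 e12.
apply/eqP; rewrite -subr_eq0; have [d [wE|wE]] := Zq_chain (chi1 w) (chi2 w).
  by rewrite e22 wE -mulrnAl -e21 mul0r.
by rewrite e11 wE -mulrnAl -e12 mul0r.
Qed.

(** Each unary section is affine.  Its slope does not depend on the other
    arguments: changing one of them by w changes the section by multiples of w,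
    so slopes_agree applies. *)
Lemma compatible_affine_mod k (f : operation A k) : coordinate_compatible f ->
  exists c : 'I_k -> nat, forall x,
    in_qA (f x - (f [tuple 0 | _ < k] + \sum_i tnth x i *+ c i)).
Proof.
move=> cf; pose z0 : k.-tuple A := [tuple 0 | _ < k].
have z0E i : tnth z0 i = 0 by rewrite tnth_mktuple.
have /fin_all_exists[c cE] i :
    exists c, forall u, in_qA (f (tset z0 i u) - f (tset z0 i 0) - u *+ c).
  exact: compatible_unary_affine (compatible_unary z0 i cf).
have same_slope z i u : in_qA (f (tset z i u) - f (tset z i 0) - u *+ c i).
  move: u; apply: (coordinatewise_ind (y := z0)
      (Q := fun z => forall u,
         in_qA (f (tset z i u) - f (tset z i 0) - u *+ c i))).
    exact: cE.
  move=> w j _ IHw; move: (tnth z j) => v.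
  have [->|ji] := eqVneq j i; first by move=> u; rewrite !tsetK.
  have [c' c'E] := compatible_unary_affine (compatible_unary (tset w j v) i cf).
  have cc' : c'%:R = (c i)%:R :> 'Z_q.
    apply: (@slopes_agree (v - tnth w j)) => u.
    pose D u := f (tset (tset w j v) i u) - f (tset w i u).
    have DE u' : D u' \in <[v - tnth w j]>%g.
      rewrite /D tsetC //; have := cf (tset w i u') j v.
      by rewrite tnth_tset (negPf ji).
    have /mem_cycleP[m mE] : D u - D 0 \in <[v - tnth w j]>%g.
      by rewrite addr_cycle ?oppr_cycle.
    exists m; rewrite -mE /D -cross_difference.
    by apply: in_qAD (IHw u) (in_qAN (c'E u)).
  move=> u; have := in_qAD (c'E u) (in_qA_congr u cc').
  by rewrite addrA subrK.
exists c => x.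
apply: (coordinatewise_ind (y := z0)
   (Q := fun x => in_qA (f x - (f z0 + \sum_i tnth x i *+ c i)))).
  rewrite big1 => [|i _]; last by rewrite z0E mul0rn.
  by rewrite addr0 subrr; apply: in_qA0.
move=> z i zi IHz.
have /(in_qAD IHz) := same_slope z i (tnth x i).
have zi0 : tnth z i = 0 by rewrite zi z0E.
have -> : tset z i 0 = z by rewrite -zi0 tset_id.
have -> : \sum_j tnth (tset z i (tnth x i)) j *+ c j
    = \sum_j tnth z j *+ c j + tnth x i *+ c i.
  rewrite (bigD1 i) //= [in RHS](bigD1 i) //= zi0 mul0rn add0r addrC.
  rewrite tnth_tset eqxx.
  by congr (_ + _); apply: eq_bigr => j /negPf ji; rewrite tnth_tset ji.
by rewrite !opprD !addrA [X in in_qA X -> _](ACl (4*2*3*6*1*5)) /= addrK.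
Qed.

Hypothesis e2_torsion : e2 *+ q = 0.
Hypothesis e1_complement : forall x, exists s k, x = e1 *+ s + k /\ k *+ q = 0.

(** What is left after the subtraction of an affine function takes values in
    p^b A. *)
Section Remainder.

Variables (k : nat) (h : operation A k).
Hypotheses (ch : coordinate_compatible h) (hq : forall x, in_qA (h x)).

Let shift (x : k.-tuple A) i (u : A) := tset x i (tnth x i + u).

Let shift_cycle x i u : exists s, h (shift x i u) - h x = u *+ s.
Proof.
apply/mem_cycleP; have := ch x i (tnth x i + u).
by rewrite (addrC _ u) addrK addrC.
Qed.

Let chi2_shift x i u s : h (shift x i u) - h x = u *+ s -> chi2 u *+ s = 0.
Proof.
move=> sE; rewrite -(raddfMn chi2) -sE.
exact: chi_qA (in_qAD (hq _) (in_qAN (hq x))).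
Qed.

Let shiftD x i u v : shift (shift x i u) i v = shift x i (u + v).
Proof. by rewrite /shift tsetK tnth_tset eqxx addrA. Qed.

(* The change is a multiple u *+ s in p^b A, and chi2 u = 1 forces p^b to
   divide s. *)
Let shift_unit x i u : u *+ q = 0 -> chi2 u = 1 -> h (shift x i u) = h x.
Proof.
move=> uq chiu; have [s sE] := shift_cycle x i u.
have /eqP := chi2_shift sE; rewrite chiu Zq_natr_eq0 => /dvdnP[t st].
by apply/eqP; rewrite -subr_eq0 sE st mulnC mulrnA uq mul0rn.
Qed.

Let shift_e2 x i m : h (shift x i (e2 *+ m)) = h x.
Proof.
elim: m => [|m IHm]; first by rewrite /shift mulr0n addr0 tset_id.
by rewrite mulrSr -shiftD shift_unit.
Qed.

(* Add a multiple of e2 to reach the case chi2 u = 1. *)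
Let shift_torsion x i u : u *+ q = 0 -> h (shift x i u) = h x.
Proof.
move=> uq; pose z : 'Z_q := (1 : 'Z_q) - chi2 u; pose m : nat := z.
rewrite -(shift_e2 _ i m) shiftD shift_unit //.
  by rewrite mulrnDl uq add0r mulrnAC e2_torsion mul0rn.
by rewrite raddfD (raddfMn chi2) chi22 /m natr_Zp addrC subrK.
Qed.

(* Write u as a multiple of e1 plus an element killed by p^b, which may be
   replaced by e2.  Then chi2 is 1 on the displacement, so the multiplier is
   divisible by p^b and annihilates the e2 part. *)
Let shift_qA x i u : exists t, h (shift x i u) - h x = u *+ (q * t).
Proof.
have [s [v [-> vq]]] := e1_complement u.
rewrite -shiftD shift_torsion // -(shift_e2 _ i 1) shiftD mulr1n.
have [t tE] := shift_cycle x i (e1 *+ s + e2).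
have := chi2_shift tE; rewrite raddfD (raddfMn chi2) chi21 mul0rn add0r chi22.
move/eqP; rewrite Zq_natr_eq0 => /dvdnP[r rE]; exists r.
by rewrite tE rE mulnC !mulrnDl !(mulrnA _ q) vq e2_torsion.
Qed.

(** A displacement by v *+ p^j changes h by a multiple of v *+ p^(j+b), and b is
    positive. *)
Lemma remainder_lifting : lifting_by p h.
Proof.
move=> j x y xy.
apply: (coordinatewise_ind (y := y)
  (Q := fun z => exists v, h z - h y = v *+ p ^ j.+1)).
  by exists 0; rewrite subrr mul0rn.
move=> z i zi [w wE]; have [v vE] := xy i; rewrite -zi in vE.
have [t tE] := shift_qA z i (tnth x i - tnth z i).
exists (w + v *+ (p ^ b.-1 * t)).
rewrite mulrnDl -wE -mulrnA mulnAC -expnD -addSnnS addnC.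
have -> : v *+ (p ^ (j + b.-1.+1) * t) = h (tset z i (tnth x i)) - h z.
  rewrite prednK // expnD -mulnA mulrnA -vE -tE /shift.
  by rewrite (addrC (tnth z i)) subrK.
by rewrite [RHS]addrC addrA subrK.
Qed.

End Remainder.

Lemma compatible_splits k (f : operation A k) :
  coordinate_compatible f -> splits_off_affine p f.
Proof.
move=> cf; have [c cE] := compatible_affine_mod cf.
pose l : operation A k := fun x => f [tuple 0 | _ < k] + \sum_i tnth x i *+ c i.
exists (f [tuple 0 | _ < k]), c, (fun x => f x - l x); split=> [|x].
  apply: remainder_lifting => [|x]; last exact: cE.
  apply: compatible_addr => //; apply: compatible_oppr.
  apply: compatible_addr; first exact: compatible_cst.
  apply: compatible_sum => i; apply: compatible_mulrn; exact: compatible_tnth.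
by rewrite addrC subrK.
Qed.

(** Multiplication by p^(a-1) kills every element that is killed by p^b, so it
    maps A onto the multiples of c = p^(a-1) e1, a group of prime order.  If the
    test changes with the i-th argument, then p^(a-1) does not kill the
    displacement w, and w *+ p^(a-1) generates that group. *)
Lemma spike a k : (b < a)%N -> e1 *+ p ^ a = 0 ->
  exists2 f : operation A k, coordinate_compatible f &
    forall S,
      f (vertex 0 e1 S) = if S == [set: 'I_k] then e1 *+ p ^ a.-1 else 0.
Proof.
case: a => // a; rewrite ltnS => leba e1a.
set c := e1 *+ p ^ a; have cp : c *+ p = 0 by rewrite -mulrnA -expnSr.
have [c0|c_neq0] := eqVneq c 0.
  exists (fun=> 0); first exact: compatible_cst.
  by move=> S; rewrite /= -/c c0 if_same.
exists (fun x => if [forall i, tnth x i *+ p ^ a != 0] then c else 0) => [|S].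
  apply: switch_compatible => x i u neq; set w := u - tnth x i.
  have wa : w *+ p ^ a != 0.
    apply: contraNneq neq => /eqP; rewrite mulrnBl subr_eq0 => /eqP eq_u.
    apply/eqP/eq_forallb => j; rewrite tnth_tset; case: (j =P i) => // ->.
    by rewrite eq_u.
  have [s [v [wE vq]]] := e1_complement w.
  have {}wE : w *+ p ^ a = c *+ s.
    rewrite wE mulrnDl -(subnKC leba) expnD (mulrnA v) vq mul0rn addr0 -expnD.
    by rewrite subnKC // mulrnAC.
  have cop : coprime #[c]%g s.
    apply: (@coprime_dvdl _ p); first by rewrite order_dvdn zmodXgE cp.
    rewrite prime_coprime //; apply: contra wa => /dvdnP[t st].
    by rewrite wE st mulnC mulrnA cp mul0rn.
  have : generator <[c]>%g (c ^+ s)%g by rewrite generator_coprime.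
  rewrite /generator zmodXgE -wE => /eqP eqc.
  have : c \in <[c]>%g by apply: cycle_id.
  rewrite eqc; apply/subsetP; rewrite cycle_subG; exact: mulrn_cycle.
congr (if _ then _ else _).
apply/forallP/eqP => [Sall|-> i]; last by rewrite tnth_mktuple inE.
apply/setP => i; rewrite inE; have := Sall i; rewrite tnth_mktuple.
by case: (i \in S); rewrite // mul0rn eqxx.
Qed.

End DualPair.

(** * The dichotomy for finite abelian p-groups *)

(** A discrete logarithm: i is determined modulo the order of x by
    y - x *+ i in H. *)
Lemma cyclic_factor_character (A : finZmodType) (x : A) (H : {set A}) q :
    (<[x]> \x H = [set: A])%g -> (q %| #[x]%g)%N -> (1 < q)%N ->
  exists chi : {additive A -> 'Z_q},
    chi x = 1 /\ forall h, h \in H -> chi h = 0.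
Proof.
case/dprodP=> -[K L _ defH]; rewrite {}defH => defA _ tiKH q_x q_gt1.
have uniq_log i j : x *+ i - x *+ j \in L -> i%:R = j%:R :> 'Z_q.
  move=> Hij; have : x *+ i - x *+ j \in [1 A]%g.
    by rewrite -tiKH inE Hij andbT addr_cycle ?oppr_cycle ?mulrn_cycle.
  move/set1gP/eqP; rewrite zmod1gE subr_eq0 -!zmodXgE eq_expg_mod_order.
  move=> eq_ij; apply/val_inj; rewrite /= !val_Zp_nat //.
  by rewrite -(modn_dvdm i q_x) (eqP eq_ij) modn_dvdm.
have has_log y : exists i : nat, y - x *+ i \in L.
  have: y \in (<[x]> * L)%g by rewrite defA inE.
  case/mulsgP=> _ h /mem_cycleP[i ->] Hh ->; exists i.
  by rewrite zmodMgE addrC addKr.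
pose chi y : 'Z_q := (xchoose (has_log y))%:R.
have chiE y i : y - x *+ i \in L -> chi y = i%:R.
  move=> Hi; apply: uniq_log; have Hc := xchooseP (has_log y).
  have -> : x *+ xchoose (has_log y) - x *+ i
      = (y - x *+ i) - (y - x *+ xchoose (has_log y)).
    by rewrite opprB [RHS]addrC addrA subrK.
  by rewrite groupM ?groupV.
have chiD : {morph chi : y z / y + z}.
  move=> y z; rewrite /chi -natrD; apply: chiE.
  rewrite mulrnDr opprD addrACA.
  exact: groupM (xchooseP (has_log y)) (xchooseP (has_log z)).
have chi0 : chi 0 = 0 by apply: (chiE 0 0%N); rewrite mulr0n subr0 group1.
have chi_mor : nmod_morphism chi by split.
pose chiM := GRing.isNmodMorphism.Build A 'Z_q chi chi_mor.
pose chiA : {additive A -> 'Z_q} := HB.pack chi chiM.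
exists chiA; split=> [|h Hh].
  by apply: (chiE x 1%N); rewrite mulr1n subrr group1.
by apply: (chiE h 0%N); rewrite mulr0n subr0.
Qed.

Lemma bigdprod_cycle_exponent (A : finZmodType) (r : seq A) (H : {group A}) q :
    (\big[dprod/1]_(x <- r) <[x]> = H)%g -> all (fun x => #[x]%g %| q) r ->
  forall h, h \in H -> h *+ q = 0.
Proof.
elim: r H => [|x r IHr] H /=.
  by rewrite big_nil => defH _ h; rewrite -defH => /set1gP ->; rewrite mul0rn.
rewrite big_cons => /dprodP[[_ L _ defL] defH _ _] /andP[xq rq] h.
rewrite -defH defL => /mulsgP[_ {}h /mem_cycleP[i ->] hL ->].
rewrite zmodMgE mulrnDl (IHr _ defL rq h hL) addr0 mulrnAC.
by move: xq; rewrite order_dvdn zmodXgE => /eqP ->; rewrite mul0rn.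
Qed.

(** The first two factors of the decomposition into cyclic groups of decreasing
    orders, each of which divides the previous one. *)
Lemma noncyclic_dual_pair (A : finZmodType) (p : nat) :
    prime p -> (p.-group [set: A])%g -> ~~ cyclic [set: A] ->
  exists (a b : nat) (e1 e2 : A) (chi1 chi2 : {additive A -> 'Z_(p ^ b)}),
    [/\ (0 < b)%N /\ (b <= a)%N,
        [/\ chi1 e1 = 1, chi1 e2 = 0, chi2 e1 = 0 & chi2 e2 = 1],
        e2 *+ p ^ b = 0,
        forall x, exists s k, x = e1 *+ s + k /\ k *+ p ^ b = 0 &
        e1 *+ p ^ a = 0 /\ e1 *+ p ^ a.-1 != 0].
Proof.
move=> p_pr pA ncA.
have [r defA orders] := abelian_structure (zmod_abelian [set: A]).
have := abelian_type_dvdn_sorted [set: A]; have := abelian_type_gt1 [set: A].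
rewrite -{}orders; case: r defA => [|e1 [|e2 r]].
- by rewrite big_nil => defA; rewrite -defA cyclic1 in ncA.
- by rewrite big_seq1 => defA; rewrite -defA cycle_cyclic in ncA.
rewrite /= !big_cons => defA /and3P[gt1e1 gt1e2 _] /andP[e21 sorted_r].
have p_elt (x : A) : exists n, #[x]%g = (p ^ n)%N.
  by have [n nE] := p_natP (mem_p_elt pA (in_setT x)); exists n.
have [a e1a] := p_elt e1; have [b e2b] := p_elt e2.
have b_gt0 : (0 < b)%N by move: gt1e2; rewrite e2b; case: b {e2b}.
have a_gt0 : (0 < a)%N by move: gt1e1; rewrite e1a; case: a {e1a}.
have q_gt1 : (1 < p ^ b)%N by rewrite -e2b.
have ba : (b <= a)%N by move: e21; rewrite e1a e2b dvdn_Pexp2l ?prime_gt1.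
have defA2 := defA; rewrite dprodA (dprodC <[e1]>%g) -dprodA in defA2.
have q_e1 : (p ^ b %| #[e1]%g)%N by rewrite -e2b.
have q_e2 : (p ^ b %| #[e2]%g)%N by rewrite -e2b.
have [chi1 [chi11 chi1H]] := cyclic_factor_character defA q_e1 q_gt1.
have [chi2 [chi22 chi2H]] := cyclic_factor_character defA2 q_e2 q_gt1.
have [[_ H _ defH] defAm _ _] := dprodP defA.
have [[_ H2 _ defH2] _ _ _] := dprodP defA2.
exists a, b, (e1 : A), (e2 : A), chi1, chi2; split=> //.
- split=> //.
    have [[_ L _ defL] mulL _ _] := dprodP defH; apply: chi1H.
    by rewrite defH -mulL defL (subsetP (mulG_subl _ _)) ?cycle_id.
  have [[_ L _ defL] mulL _ _] := dprodP defH2; apply: chi2H.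
  by rewrite defH2 -mulL defL (subsetP (mulG_subl _ _)) ?cycle_id.
- by rewrite -e2b -zmodXgE expg_order.
- move=> x; have : x \in [set: A] by rewrite inE.
  rewrite -defAm defH => /mulsgP[_ h /mem_cycleP[s ->] hH ->].
  exists s, h; split=> //.
  apply: (bigdprod_cycle_exponent (r := e2 :: r) (H := H)) => //.
    by rewrite big_cons.
  rewrite /= -e2b dvdnn /=.
  have dvd_trans : transitive [rel m n : nat | n %| m].
    by move=> m l n /= ml nm; apply: dvdn_trans ml.
  by have := order_path_min dvd_trans sorted_r; rewrite all_map.
rewrite -e1a -!zmodXgE expg_order; split=> //.
by rewrite -order_dvdn e1a dvdn_Pexp2l ?prime_gt1 // -ltnNge prednK.
Qed.

Lemma affine_polynomial (A : finZmodType) k (f : operation A k) c0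
    (c : 'I_k -> nat) :
    (0 < k)%N -> (forall x, f x = c0 + \sum_i tnth x i *+ c i) ->
  polynomial_function (A := group_algebra A) f.
Proof.
move=> k_gt0 fE; exists 1%N, [tuple c0].
exists (fun y => tnth y (rshift k ord0) + \sum_i tnth y (lshift 1 i) *+ c i).
split=> [|x]; last first.
  rewrite fE; congr (_ + _); last apply: eq_bigr => i _.
    by rewrite tnth_rshift.
  by rewrite tnth_lshift.
have addT := clone_generator (@basic_op (group_algebra A)) GroupMul.
have zeroT : clone_generated (@basic_op (group_algebra A))
    (fun _ : 1.-tuple A => 0).
  apply: (@clone_comp _ _ _ _ _ _ GroupOne (fun i x => tnth x ord0)) => // i.
  exact: clone_tnth.
apply: (clone_addr addT); first exact: clone_tnth.
have kl_gt0 : (0 < k + 1)%N by rewrite addn1.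
apply: (clone_sum addT zeroT _ kl_gt0) => i.
by apply: (clone_mulrn addT zeroT _ kl_gt0); apply: clone_tnth.
Qed.

(** The orders p^a and p^b of the two largest cyclic factors decide: if they are
    equal then p^b A = 0 and compatible functions are affine, and otherwise no
    finite set of compatible functions generates the spikes of all arities. *)
Theorem pgroup_fg_cyclic_or_affine_complete (A : finZmodType) (p : nat) :
    prime p -> (p.-group [set: A])%g ->
    finitely_generated (@Comp (group_algebra A)) ->
  cyclic [set: A] \/ affine_complete (group_algebra A).
Proof.
move=> p_pr pA fgA; have [|ncA] := boolP (cyclic [set: A]); first by left.
have [a [b [e1 [e2 [chi1 [chi2]]]]]] := noncyclic_dual_pair p_pr pA ncA.
case=> -[b_gt0 ba] [chi11 chi12 chi21 chi22] e2q e1q [e1a e1a1]; right.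
move: ba; rewrite leq_eqVlt => /orP[/eqP eq_ba|ltba]; last first.
  have splitA k (f : operation A k) :
      coordinate_compatible f -> splits_off_affine p f.
    exact: (compatible_splits p_pr b_gt0 chi11 chi12 chi21 chi22 e2q e1q).
  case: (not_finitely_generated (e := e1) pA splitA e1a1 _ fgA) => k.
  exact: (spike p_pr e1q k ltba e1a).
have killA (x : A) : x *+ p ^ b = 0.
  have [s [v [-> vq]]] := e1q x.
  by rewrite mulrnDl vq addr0 mulrnAC eq_ba e1a mul0rn.
move=> k f /CompP[k_gt0 cf].
have [c cE] := compatible_affine_mod p_pr b_gt0 chi11 chi12 chi21 chi22 cf.
apply: (affine_polynomial (c0 := f [tuple 0 | _ < k]) (c := c) k_gt0) => x.
by have [v] := cE x; rewrite killA => /eqP; rewrite subr_eq0 => /eqP.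
Qed.

(** * Retracts *)

Section Retract.

Variables (A B : finZmodType) (iota : B -> A) (pi : A -> B).
Hypothesis iotaD : {morph iota : x y / x + y}.
Hypothesis piD : {morph pi : x y / x + y}.
Hypothesis iotaK : cancel iota pi.
Hypothesis iota_pi : forall x, iota (pi x) \in <[x]>%g.

Let morph0 (U V : zmodType) (phi : U -> V) :
  {morph phi : x y / x + y} -> phi 0 = 0.
Proof. by move=> phiD; apply: (addrI (phi 0)); rewrite -phiD !addr0. Qed.

Let morphN (U V : zmodType) (phi : U -> V) x :
  {morph phi : x y / x + y} -> phi (- x) = - phi x.
Proof.
by move=> phiD; apply: (addrI (phi x)); rewrite -phiD !subrr morph0.
Qed.

Let morphMn (U V : zmodType) (phi : U -> V) x n :
  {morph phi : x y / x + y} -> phi (x *+ n) = phi x *+ n.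
Proof.
move=> phiD; elim: n => [|n IHn]; first by rewrite !mulr0n morph0.
by rewrite !mulrS phiD IHn.
Qed.

Definition lift_op k (f : operation B k) : operation A k :=
  fun x => iota (f [tuple pi (tnth x i) | i < k]).

Definition restrict_op k (g : operation A k) : operation B k :=
  fun y => pi (g [tuple iota (tnth y i) | i < k]).

Let map_tset (U V : Type) (phi : U -> V) k (x : k.-tuple U) i u :
  [tuple phi (tnth (tset x i u) j) | j < k]
    = tset [tuple phi (tnth x j) | j < k] i (phi u).
Proof.
apply: eq_from_tnth => j; rewrite !(tnth_mktuple, tnth_tset).
by case: (j == i).
Qed.

Lemma lift_compatible k (f : operation B k) :
  coordinate_compatible f -> coordinate_compatible (lift_op f).
Proof.
move=> cf x i u; rewrite /lift_op map_tset -morphN // -iotaD.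
have /mem_cycleP[n ->] := cf [tuple pi (tnth x j) | j < k] i (pi u).
by rewrite tnth_mktuple morphMn // -morphN // -piD mulrn_in_cycle.
Qed.

Lemma restrict_compatible k (g : operation A k) :
  coordinate_compatible g -> coordinate_compatible (restrict_op g).
Proof.
move=> cg y i u; rewrite /restrict_op map_tset -morphN // -piD.
have /mem_cycleP[n ->] := cg [tuple iota (tnth y j) | j < k] i (iota u).
by rewrite tnth_mktuple morphMn // -morphN // -iotaD iotaK mulrn_cycle.
Qed.

(** The kernel of pi is a congruence. *)
Lemma restrictE k (g : operation A k) x : coordinate_compatible g ->
  restrict_op g [tuple pi (tnth x i) | i < k] = pi (g x).
Proof.
move=> cg; rewrite /restrict_op; set y := mktuple _.
have yE i : tnth y i = iota (pi (tnth x i)) by rewrite !tnth_mktuple.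
apply/esym; apply: (coordinatewise_ind (y := y)
  (Q := fun z => pi (g z) = pi (g y))) => //.
move=> z i zi <-; apply/eqP; rewrite -subr_eq0 -morphN // -piD.
have /mem_cycleP[n ->] := cg z i (tnth x i).
by rewrite morphMn // piD morphN // zi yE iotaK subrr mul0rn.
Qed.

(** By restrictE, restriction is compatible with composition, and it undoes
    lifting. *)
Lemma retract_finitely_generated :
    finitely_generated (@Comp (group_algebra A)) ->
  finitely_generated (@Comp (group_algebra B)).
Proof.
move=> [m [ar [F [CF genF]]]].
have cF i : coordinate_compatible (F i) by have /CompP[] := CF i.
exists m, ar, (fun i => restrict_op (F i)); split=> [i|k f /CompP[k_gt0 cf]].
  have /CompP[ar_gt0 _] := CF i.
  by apply/CompP; split=> //; apply: restrict_compatible.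
have {}genF : clone_generated F (lift_op f).
  by apply: genF; apply/CompP; split=> //; apply: lift_compatible.
have restrict_gen (g : operation A k) : clone_generated F g ->
    clone_generated (fun i => restrict_op (F i)) (restrict_op g).
  elim=> {g} [g j gE|g i h _ IHh gE].
    apply: (@clone_proj _ _ _ _ _ _ j) => y.
    by rewrite /restrict_op gE tnth_mktuple iotaK.
  apply: (clone_comp IHh) => y; rewrite {1}/restrict_op gE -restrictE //.
  by congr (restrict_op _ _); apply: eq_from_tnth => j; rewrite !tnth_mktuple.
apply: (eq_clone _ (restrict_gen _ genF)) => y.
rewrite /restrict_op /lift_op iotaK; congr f.
by apply: eq_from_tnth => j; rewrite !tnth_mktuple iotaK.
Qed.

(** Lifting turns the j-th projection of B into the map iota o pi applied to the
    j-th variable, which is why this map is added to the generators. *)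
Lemma lift_generated : finitely_generated (@Comp (group_algebra B)) ->
  exists (I : finType) (ar : I -> nat) (F : forall i, operation A (ar i)),
    (forall i, @Comp (group_algebra A) _ (F i)) /\
    forall k (f : operation A k), @Comp (group_algebra A) _ f ->
      clone_generated F (fun x => iota (pi (f x))).
Proof.
move=> [m [ar [G [CG genG]]]].
pose ar' (i : option 'I_m) := if i is Some i' then ar i' else 1%N.
pose F (i : option 'I_m) : operation A (ar' i) :=
  match i with
  | Some i' => lift_op (G i')
  | None => fun x => iota (pi (tnth x ord0))
  end.
have genF k (g : operation B k) :
    clone_generated G g -> clone_generated F (lift_op g).
  elim=> {g} [g j gE|g i h _ IHh gE].
    have cj := clone_app1 (clone_generator F None) (clone_tnth F j).
    apply: (eq_clone _ cj) => x.
    by rewrite /lift_op gE tnth_mktuple.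
  apply: (@clone_comp _ _ _ _ _ _ (Some i) (fun j => lift_op (h j))) => // x.
  rewrite /= /lift_op gE; congr (iota (G i _)); apply: eq_from_tnth => j.
  by rewrite !tnth_mktuple iotaK.
exists (option 'I_m), ar', F; split=> [[i|]|k f /CompP[k_gt0 cf]].
- have /CompP[ar_gt0 cG] := CG i.
  by apply/CompP; split=> //; apply: lift_compatible.
- apply/CompP; split=> // x i u; rewrite /= tnth_tset (ord1 i) eqxx.
  by rewrite -morphN // -iotaD -morphN // -piD.
have genf : clone_generated G (restrict_op f).
  by apply: genG; apply/CompP; split=> //; apply: restrict_compatible.
by apply: (eq_clone _ (genF _ _ genf)) => x; rewrite /lift_op restrictE.
Qed.

End Retract.

(** * Sylow subgroups *)

(** A copy of an abelian group with an additive structure.  The operations are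
    convertible to those of gT, and so are the two group algebras: statements
    about clones carry over without any transfer. *)
Definition additive_group (gT : finGroupType) (abG : abelian [set: gT]) :
  Type := gT.

Section Additive.

Variables (gT : finGroupType) (abG : abelian [set: gT]).
Local Notation U := (additive_group abG).

HB.instance Definition _ := Finite.copy U gT.

Fact additive_addC : commutative (fun x y : U => (x * y)%g : U).
Proof. by move=> x y; apply: (centsP abG); rewrite inE. Qed.

HB.instance Definition _ := GRing.isZmodule.Build U
  (@mulgA gT) additive_addC (@mul1g gT) (@mulVg gT).

Let A : finZmodType := additive_group abG.

Lemma additive_mulrn (x : gT) n : (x : A) *+ n = (x ^+ n)%g.
Proof. by elim: n => // n IHn; rewrite mulrS IHn expgS. Qed.

Lemma cycle_additive (x y : gT) :
  y \in <[x]>%g -> (y : A) \in @cycle A x.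
Proof.
by case/cycleP=> n ->; rewrite -additive_mulrn mulrn_cycle.
Qed.

Lemma additive_cycle (x y : A) :
  y \in <[x]>%g -> (y : gT) \in @cycle gT x.
Proof.
by case/mem_cycleP=> n ->; apply/cycleP; exists n; apply: additive_mulrn.
Qed.

Lemma cyclic_additive : cyclic [set: A] = cyclic [set: gT].
Proof.
apply/cyclicP/cyclicP=> -[x defT]; exists x.
  apply/setP=> y; rewrite inE; apply/esym.
  by apply: additive_cycle; rewrite -defT inE.
apply/setP=> y; rewrite inE; apply/esym.
by apply: cycle_additive; rewrite -defT inE.
Qed.

Lemma pgroup_additive (p : nat) :
  (p.-group [set: A])%g = (p.-group [set: gT])%g.
Proof. by rewrite /pgroup !cardsT. Qed.

End Additive.

Section Sylow.

Variables (gT : finGroupType) (abG : abelian [set: gT]).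
Variables (p : nat) (P : {group gT}).
Hypothesis sylP : (p.-Sylow([set: gT]) P)%g.

Definition sylow_proj (x : gT) : subg_of P := subg P (x.`_p)%g.

Lemma sylow_projK x : sgval (sylow_proj x) = (x.`_p)%g.
Proof.
rewrite subgK // (mem_normal_Hall sylP) ?inE ?p_elt_constt //.
by rewrite -sub_abelian_normal ?subsetT.
Qed.

Lemma sylow_projM : {morph sylow_proj : x y / (x * y)%g}.
Proof.
move=> x y; apply: val_inj; rewrite /= !sylow_projK consttM //.
by apply: (centsP abG); rewrite inE.
Qed.

Lemma sgval_sylow_proj : cancel sgval sylow_proj.
Proof.
move=> x; apply: val_inj; rewrite /= sylow_projK constt_p_elt //.
exact: mem_p_elt (pHall_pgroup sylP) (subgP x).
Qed.

Lemma sylow_proj_cycle x : sgval (sylow_proj x) \in <[x]>%g.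
Proof. by rewrite sylow_projK mem_cycle. Qed.

Lemma abelian_subg : abelian [set: subg_of P].
Proof.
apply/centsP => x _ y _; apply: val_inj; apply: (centsP abG); by rewrite inE.
Qed.

Lemma pgroup_subg : (p.-group [set: subg_of P])%g.
Proof.
by rewrite /pgroup -(card_isog (isog_subg P)); apply: pHall_pgroup sylP.
Qed.

Lemma cyclic_subg : cyclic [set: subg_of P] = cyclic P.
Proof. by rewrite -(isog_cyclic (isog_subg P)). Qed.

Let A : finZmodType := additive_group abG.
Let B : finZmodType := additive_group abelian_subg.

Lemma sylow_fg_cyclic_or_affine_complete : prime p ->
    finitely_generated (@Comp (group_algebra gT)) ->
  cyclic P \/ affine_complete (group_algebra (subg_of P)).
Proof.
move=> p_pr fgG; rewrite -cyclic_subg -(cyclic_additive abelian_subg).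
have fgP : finitely_generated (@Comp (group_algebra B)).
  apply: (@retract_finitely_generated A B sgval sylow_proj) => //.
  - exact: sylow_projM.
  - exact: sgval_sylow_proj.
  - by move=> x; apply/cycle_additive/sylow_proj_cycle.
apply: (pgroup_fg_cyclic_or_affine_complete p_pr _ fgP).
by rewrite pgroup_additive pgroup_subg.
Qed.

(** The p-component of f is the lift of the restriction of f to P. *)
Lemma sylow_component_generated : prime p ->
    cyclic P \/ affine_complete (group_algebra (subg_of P)) ->
  exists (I : finType) (ar : I -> nat) (F : forall i, operation gT (ar i)),
    (forall i, @Comp (group_algebra gT) _ (F i)) /\
    forall k (f : operation gT k), @Comp (group_algebra gT) _ f ->
      clone_generated F (fun x => ((f x).`_p)%g).
Proof.
move=> p_pr cycP.
have fgP : finitely_generated (@Comp (group_algebra B)).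
  case: cycP => [cycP|acP]; last exact: (@affine_complete_fg B acP).
  apply: (cyclic_pgroup_fg p_pr); first by rewrite pgroup_additive pgroup_subg.
  by rewrite cyclic_additive cyclic_subg.
have [||||I [ar [F [CF genF]]]] := @lift_generated A B
    sgval sylow_proj _ _ _ _ fgP => //.
- exact: sylow_projM.
- exact: sgval_sylow_proj.
- by move=> x; apply/cycle_additive/sylow_proj_cycle.
exists I, ar, F; split=> // k f /genF.
by apply: eq_clone => x; apply: sylow_projK.
Qed.

End Sylow.

Lemma constt_nonprime (gT : finGroupType) (x : gT) (p : nat) :
  ~~ prime p -> (x.`_p)%g = 1%g.
Proof.
move=> npr; apply/constt1P/pnatP => // q q_pr _; apply/negP => /eqP qp.
by rewrite -qp q_pr in npr.
Qed.

Lemma prod_constt_card (gT : finGroupType) (x : gT) :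
  (\prod_(0 <= p < #|gT|.+1) x.`_p = x)%g.
Proof.
have le_x : (#[x]%g <= #|gT|)%N by rewrite max_card.
rewrite -[RHS]prod_constt (big_cat_nat (n := #[x]%g.+1)) //=.
rewrite [X in (_ * X)%g]big_nat_cond.
rewrite [X in (_ * X)%g]big1 ?mulg1 // => p /andP[/andP[ltxp _] _].
apply/constt1P/pnatP => // q _ q_x; apply/negP => /eqP qp.
by move: ltxp; rewrite -qp ltnNge dvdn_leq.
Qed.

Theorem theorem1p2 (gT : finGroupType) (abG : abelian [set: gT]) :
  finitely_generated (@Comp (group_algebra gT)) <->
  forall (p : nat) (P : {group gT}), prime p -> (p.-Sylow([set: gT]) P)%g ->
    cyclic P \/ affine_complete (group_algebra (subg_of P)).
Proof.
split=> [fgG p P p_pr sylP|cycG].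
  exact: (sylow_fg_cyclic_or_affine_complete abG sylP).
pose A : finZmodType := additive_group abG.
(* The generators of the p-components are collected prime by prime. *)
have components N :
    exists (I : finType) (ar : I -> nat) (F : forall i, operation A (ar i)),
    (forall i, @Comp (group_algebra A) _ (F i)) /\
    forall k (f : operation A k), @Comp (group_algebra A) _ f ->
      forall p : nat, (p < N)%N -> prime p ->
      clone_generated F (fun x => ((f x : gT).`_p)%g).
  elim: N => [|N [I [ar [F [CF genF]]]]].
    by exists void, (fun=> 0%N), (fun (i : void) _ => 0).
  have [N_pr|N_npr] := boolP (prime N); last first.
    exists I, ar, F; split=> // k f /genF {}genF p.
    rewrite ltnS leq_eqVlt => /orP[/eqP-> N_pr|]; last exact: genF.
    by rewrite N_pr in N_npr.
  have [P sylP] := Sylow_exists N [set: gT].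
  have [J [br [F' [CF' genF']]]] :=
    sylow_component_generated abG sylP N_pr (cycG N P N_pr sylP).
  pose ar2 (i : I + J) := match i with inl i => ar i | inr j => br j end.
  pose F2 (i : I + J) : operation A (ar2 i) :=
    match i with inl i => F i | inr j => F' j end.
  exists (I + J)%type, ar2, F2.
  split=> [[i|j]|k f Cf p]; [exact: CF | exact: CF' |].
  rewrite ltnS leq_eqVlt => /orP[/eqP-> _|ltpN p_pr].
    apply: clone_generated_sub (genF' k f Cf) => j.
    exact: (clone_generator F2 (inr j)).
  apply: clone_generated_sub (genF k f Cf p ltpN p_pr) => i.
  exact: (clone_generator F2 (inl i)).
have [I [ar [F [CF genF]]]] := components #|gT|.+1.
pose ar2 (i : I + bool) :=
  match i with inl i => ar i | inr true => 2 | inr false => 1%N end.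
pose F2 (i : I + bool) : operation A (ar2 i) :=
  match i return operation A (ar2 i) with
  | inl i => F i
  | inr true => fun x => tnth x ord0 + tnth x ord_max
  | inr false => fun=> 0
  end.
apply: (@finitely_generated_fin A _ _ ar2 F2) => [[i|[]]|k f Cf].
- exact: CF.
- by apply/(CompP (A := A)); split=> //; apply: compatible_add.
- by apply/(CompP (A := A)); split=> //; apply: compatible_cst.
have addF := clone_generator F2 (inr true).
have zeroF := clone_generator F2 (inr false).
have [k_gt0 _] := Cf.
(* The cutoff makes the statement hold for all p, as needed for a sum over an
   interval of natural numbers. *)
have comp p : clone_generated F2
    (fun x : k.-tuple A =>
       if (p < #|gT|.+1)%N then ((f x : gT).`_p)%g : A else 0).
  case: (boolP (p < #|gT|.+1)%N) => ltpG; last exact: (clone_cst zeroF).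
  have [p_pr|p_npr] := boolP (prime p); last first.
    apply: (eq_clone _ (clone_cst zeroF k_gt0)) => x.
    by rewrite constt_nonprime.
  apply: clone_generated_sub (genF k f Cf p ltpG p_pr) => i.
  exact: (clone_generator F2 (inl i)).
have cf := clone_sum addF zeroF (index_iota 0 #|gT|.+1) k_gt0 comp.
apply: (eq_clone _ cf) => x.
rewrite -[RHS](@prod_constt_card gT) big_nat [RHS]big_nat.
apply: eq_bigr => p /andP[_ ltp]; exact: ifT.
Qed.
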